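(* Let $\mathcal H$ be a real Hilbert space and $\gamma>0$. Assume: (a) $\Phi:\mathcal H\to\mathbb R$ is convex and differentiable, $\nabla\Phi$ is Lipschitz continuous on bounded subsets of $\mathcal H$, and $C:=\operatorname{argmin}\Phi=\Phi^{-1}(0)\neq\emptyset$ (so $\min_{\mathcal H}\Phi=0$); (b) $\Psi:\mathcal H\to\mathbb R$ is convex and differentiable, $\nabla\Psi$ is Lipschitz continuous on bounded subsets of $\mathcal H$, and $\Psi$ is bounded from below; (c) $S:=\operatorname{argmin}_C\Psi=\{z\in C:\Psi(z)=\min_C\Psi\}$ is nonempty; (d) $\epsilon:[0,+\infty[\to]0,+\infty[$ is nonincreasing, of class $C^1$, and $\epsilon(t)\to0$, $\dot\epsilon(t)\to0$ as $t\to+\infty$. Let $x$ be a classical maximal solution of $$\ddot x(t)+\gamma\dot x(t)+\nabla\Phi(x(t))+\epsilon(t)\nabla\Psi(x(t))=0 .$$ Then $x$ is defined on $[0,+\infty[$. Assume moreover that: (H1) $\int_0^{+\infty}\epsilon(t)\,dt=+\infty$; (H2) for every $p\in\mathcal C$, $\int_0^{+\infty}\left[\Phi^*(\epsilon(t)p)-\sigma_C(\epsilon(t)p)\right]dt<+\infty$, where $$\mathcal C=\{\lambda p:\ \lambda\ge0,\ \exists z\in C,\ p=-\nabla\Psi(z),\ \nabla\Psi(z)+N_C(z)\ni0\};$$ (H3) there is a constant $k>0$ such that $0\le-\dot\epsilon(t)\le k\,\epsilon^2(t)$ for all large enough $t$. Then: (i) there exists $x_\infty\in S$ such that $x(t)$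 converges weakly in $\mathcal H$ to $x_\infty$ as $t\to+\infty$; (ii) $\lim_{t\to+\infty}\Phi(x(t))=0$ and $\lim_{t\to+\infty}\Psi(x(t))=\min_{C}\Psi$.
   Context: $\Phi^*(y)=\sup_{x\in\mathcal H}\{\langle y,x\rangle-\Phi(x)\}$ is the Fenchel conjugate of $\Phi$; $\sigma_C(y)=\sup_{x\in C}\langle y,x\rangle$ is the support function of $C$; $N_C(z)=\{q\in\mathcal H:\langle q,y-z\rangle\le0\ \ \forall y\in C\}$ is the outward normal cone to $C$ at $z\in C$. (The integrand in (H2) is always nonnegative.) A maximal solution starts at time $t=0$ from arbitrary Cauchy data $(x(0),\dot x(0))\in\mathcal H\times\mathcal H$, and is a solution on an interval $[0,T[$, $0<T\le+\infty$, that cannot be extended to a larger such interval. *)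

(* Defs.v *)
From HB Require Import structures.
From mathcomp Require Import all_boot all_order all_algebra.
From mathcomp Require Import sesquilinear.
From mathcomp Require Import all_classical all_reals all_analysis.

Set Implicit Arguments.
Unset Strict Implicit.
Unset Printing Implicit Defensive.

Import Order.TTheory GRing.Theory Num.Theory.
Import numFieldNormedType.Exports.

Local Open Scope classical_set_scope.
Local Open Scope ring_scope.

(* A real Hilbert space is represented by a complete normed module [H] over a
   [realType] together with a scalar product [dot : {dot H for idfun}] such
   that [`|x| ^+ 2 = dot x x]. *)

Section HilbertNotions.
Context {R : realType} {H : completeNormedModType R}.
Variable dot : {dot H for (@idfun R)}.

(* The Riesz representative of the Frechet differential of [f] at [x]; a
   default value if [f] is not differentiable at [x]. *)
Definition gradient (f : H -> R) (x : H) : H :=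
  get [set g : H | differentiable f x /\ forall v, 'd f x v = dot g v].

Definition fenchel_conjugate (f : H -> R) (y : H) : \bar R :=
  ereal_sup [set (dot y x - f x)%:E | x in [set: H]].

Definition support_function (C : set H) (y : H) : \bar R :=
  ereal_sup [set (dot y x)%:E | x in C].

Definition normal_cone (C : set H) (z : H) : set H :=
  [set q : H | forall y, C y -> dot q (y - z) <= 0].

Definition critical_cone (C : set H) (Psi : H -> R) : set H :=
  [set q : H | exists lambda p, [/\ 0 <= lambda, q = lambda *: p &
    exists z, [/\ C z, p = - gradient Psi z &
      exists2 n, normal_cone C z n & gradient Psi z + n = 0]]].

End HilbertNotions.

Section Misc.
Context {R : realType}.

Definition argmin_on (T : Type) (D : set T) (f : T -> R) : set T :=
  [set z | D z /\ forall y, D y -> f z <= f y].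

Definition lipschitz_on_bounded (V W : normedModType R) (f : V -> W) : Prop :=
  forall B : set V, bounded_set B -> [lipschitz f v | v in B].

Definition weakly_cvg (T : Type) (V : normedModType R) (F : set_system T)
    (u : T -> V) (l : V) : Prop :=
  forall phi : {linear V -> R^o}, continuous phi -> phi (u t) @[t --> F] --> phi l.

End Misc.

(* Derivatives relative to a subset [I] of the line, hence one-sided at an
   endpoint belonging to [I]; the values of [f] outside [I] are irrelevant at
   the points of [I]. *)
Section DeriveIn.
Context {R : realType} {V : normedModType R}.
Implicit Types (I : set R) (f : R -> V) (t : R).

Definition diff_quotient f t (s : R) : V := (s - t)^-1 *: (f s - f t).

Definition derivable_in I f t : Prop := cvg (diff_quotient f t @ within I t^').

Definition derive_in I f t : V := lim (diff_quotient f t @ within I t^').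

Definition C1_on I f : Prop :=
  (forall t, I t -> derivable_in I f t) /\ {within I, continuous (derive_in I f)}.

Definition C2_on I f : Prop :=
  (forall t, I t -> derivable_in I f t) /\ C1_on I (derive_in I f).

End DeriveIn.

Section Trajectories.
Context {R : realType} {H : completeNormedModType R}.
Variables (dot : {dot H for (@idfun R)}) (gamma : R) (Phi Psi : H -> R)
  (eps : R -> R).

Definition horizon (T : \bar R) : set R :=
  [set t : R | 0 <= t /\ (t%:E < T)%E].

(* Only the restriction of [x] to [0, T[ is meaningful. *)
Definition classical_solution (T : \bar R) (x : R -> H) : Prop :=
  [/\ (0 < T)%E,
      C2_on (horizon T) x &
      forall t, horizon T t ->
        derive_in (horizon T) (derive_in (horizon T) x) t
        + gamma *: derive_in (horizon T) x t
        + gradient dot Phi (x t) + eps t *: gradient dot Psi (x t) = 0].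

Definition maximal_solution (T : \bar R) (x : R -> H) : Prop :=
  classical_solution T x /\
  forall (T' : \bar R) (y : R -> H), (T < T')%E -> classical_solution T' y ->
    ~ (forall t, horizon T t -> y t = x t).

End Trajectories.

(* Main.v *)
Require Import Defs.
From HB Require Import structures.
From mathcomp Require Import all_boot all_order all_algebra.
From mathcomp Require Import sesquilinear.
From mathcomp Require Import all_classical all_reals all_analysis.
From mathcomp Require Import measurable_realfun.
From mathcomp Require Import ring lra.

Set Implicit Arguments.
Unset Strict Implicit.
Unset Printing Implicit Defensive.

Import Order.TTheory GRing.Theory Num.Theory.
Import numFieldNormedType.Exports.

Local Open Scope classical_set_scope.
Local Open Scope ring_scope.

(* Global existence: the energy |x'|^2/2 + Phi(x) + eps (Psi(x) - inf Psi) is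
   nonincreasing, so a solution on a bounded interval stays bounded; it then
   coincides with the global solution of the equation whose gradients are
   composed with the radial retraction onto a large ball, and this solution
   extends it.

   Convergence: let z in S, p = - grad Psi(z), h = |x - z|^2 / 2 and
   K = h' + gamma h. Convexity and the Fenchel inequality at 2 eps p give
   K' <= |x'|^2 - Phi(x)/2 + q/2 with q integrable by (H2). Adding multiples
   of the energy turns K into a monotone quantity, so that |x - z| converges,
   the energy vanishes, and x', Phi(x) tend to 0. By (H3), the same device makes
   the rescaled energy (|x'|^2/2 + Phi(x))/eps + Psi(x) - Psi(z) converge, and
   a positive limit would contradict (H1); hence limsup Psi(x) <= Psi(z).
   Weak cluster points of x are therefore in S, and Opial's lemma applies. *)

(** * Hilbert spaces and gradients *)

(** The cone of (H2) is stable under nonnegative multiples, which is what permits the factor 2. At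
    eps p the Fenchel inequality would consume all of the -Phi(x) available in K'; at 2 eps p it
    consumes half. The remaining -Phi(x)/2 later absorbs the Phi part of the error k (|x'|^2/2 +
    Phi(x)) that (H3) leaves in the rescaled energy; the |x'|^2 part is absorbed by E / gamma, whose
    derivative is at most -|x'|^2. Two obstacles shape the rest. No measurability of the integrand
    of (H2) is at hand, so a continuous minorant with a bounded primitive replaces it. A solution
    has only a one-sided derivative at 0, so the estimates live at positive times. Weak cluster
    points are taken along ultrafilters finer than the filter at +oo, where bounded trajectories
    have weak limits by Riesz. *)

Section Hilbert.
Context {R : realType} {H : completeNormedModType R}.
Variable dot : {dot H for (@idfun R)}.
Hypothesis dot_norm : forall u : H, `|u| ^+ 2 = dot u u.

Lemma dotC u v : dot u v = dot v u.
Proof. by have := hermC dot u v; rewrite /= expr0 mul1r. Qed.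

Lemma dotDl u v w : dot (u + v) w = dot u w + dot v w.
Proof. exact: linearDl. Qed.
Lemma dotNl u w : dot (- u) w = - dot u w.
Proof. exact: linearNl. Qed.
Lemma dotBl u v w : dot (u - v) w = dot u w - dot v w.
Proof. by rewrite dotDl dotNl. Qed.
Lemma dotZl k u w : dot (k *: u) w = k * dot u w.
Proof. exact: linearZl_LR. Qed.
Lemma dot0l w : dot 0 w = 0.
Proof. by rewrite -(scale0r 0) dotZl mul0r. Qed.
Lemma dotDr u v w : dot w (u + v) = dot w u + dot w v.
Proof. by rewrite dotC dotDl !(dotC w). Qed.
Lemma dotNr u w : dot w (- u) = - dot w u.
Proof. by rewrite dotC dotNl (dotC w). Qed.
Lemma dotBr u v w : dot w (u - v) = dot w u - dot w v.
Proof. by rewrite dotDr dotNr. Qed.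
Lemma dotZr k u w : dot w (k *: u) = k * dot w u.
Proof. by rewrite dotC dotZl (dotC w). Qed.
Lemma dot0r w : dot w 0 = 0.
Proof. by rewrite dotC dot0l. Qed.

Definition dotE := (dotDl, dotNl, dotZl, dot0l, dotDr, dotNr, dotZr, dot0r).

Lemma normD2 u v : `|u + v| ^+ 2 = `|u| ^+ 2 + 2 * dot u v + `|v| ^+ 2.
Proof. by rewrite !dot_norm !dotE (dotC v u); ring. Qed.

Lemma cauchy_schwarz u v : `|dot u v| <= `|u| * `|v|.
Proof.
have [->|v0] := eqVneq v 0; first by rewrite dot0r !normr0 mulr0.
have nv : 0 < `|v| ^+ 2 by rewrite exprn_gt0 ?normr_gt0.
rewrite -(@ler_pXn2r _ 2) ?nnegrE ?mulr_ge0// exprMn real_normK ?num_real//.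
have := sqr_ge0 `|u - (dot u v / `|v| ^+ 2) *: v|.
rewrite normD2 dotNr dotZr normrN normrZ exprMn real_normK ?num_real// => h.
have : 0 <= (`|v| ^+ 2) * (`|u| ^+ 2 + 2 * - (dot u v / `|v| ^+ 2 * dot u v)
   + (dot u v / `|v| ^+ 2) ^+ 2 * `|v| ^+ 2) by rewrite mulr_ge0// ltW.
set a := `|v| ^+ 2 in nv *.
suff -> : a * (`|u| ^+ 2 + 2 * - (dot u v / a * dot u v) + (dot u v / a) ^+ 2 * a)
  = `|u| ^+ 2 * a - dot u v ^+ 2 by rewrite subr_ge0.
by field; rewrite gt_eqF.
Qed.

Lemma dot_le u v : dot u v <= `|u| * `|v|.
Proof. exact: le_trans (ler_norm _) (cauchy_schwarz u v). Qed.

Lemma continuous_dotr (w : H) : continuous (fun u => dot u w : R^o).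
Proof.
move=> u; apply/(@cvgrPdist_le _ R^o) => e e0; near=> v.
rewrite -dotBl (le_trans (cauchy_schwarz _ _))//.
have w1 : 0 < `|w| + 1 by rewrite ltr_wpDl.
apply: (@le_trans _ _ (`|u - v| * (`|w| + 1))).
  by rewrite ler_wpM2l// lerDl.
rewrite -ler_pdivlMr//; near: v.
by apply: cvgr_dist_le => //; exact: divr_gt0.
Unshelve. all: by end_near. Qed.

Lemma dot_ext u v : (forall w, dot u w = dot v w) -> u = v.
Proof.
move=> uv; apply/eqP; rewrite -subr_eq0 -normr_eq0 -sqrf_eq0 dot_norm.
by rewrite dotBl uv subrr.
Qed.

Lemma cvg_dot (T : Type) (F : set_system T) (FF : Filter F) (u v : T -> H) a b :
  u @ F --> a -> v @ F --> b -> (dot (u t) (v t) : R^o) @[t --> F] --> (dot a b : R^o).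
Proof.
move=> ua vb.
have -> : (fun t => dot (u t) (v t) : R^o) =
  (fun t => (dot (u t - a) (v t) : R^o) + (dot (v t) a : R^o)).
  by apply/funext => t; rewrite /= dotBl (dotC a) subrK.
rewrite -[dot a b]add0r (dotC a b); apply: (@cvgD _ R^o); last first.
  by apply: (@cvg_comp _ _ _ v (fun u => dot u a : R^o) _ _ _ vb); exact: continuous_dotr.
apply/(@norm_cvg0P _ R^o)/(@squeeze_cvgr _ _ _ _ (fun=> 0) (fun t => `|u t - a| * `|v t|)).
- by near=> t; rewrite normr_ge0 cauchy_schwarz.
- exact: cvg_cst.
- rewrite -[X in _ --> X](mul0r `|b|); apply: cvgM; last exact: cvg_norm.
  by rewrite -(@normr0 _ H); apply: cvg_norm; rewrite -(subrr a); exact: cvgB (cvg_cst _).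
Unshelve. all: by end_near. Qed.

Lemma is_derive_dot (f g : R -> H) (t : R) df dg :
  is_derive t 1 f df -> is_derive t 1 g dg ->
  is_derive t 1 (fun s => dot (f s) (g s) : R^o) (dot df (g t) + dot (f t) dg).
Proof.
move=> [fd <-] [gd <-].
suff h : (fun h => h^-1 *: ((dot (f (h *: 1 + t)) (g (h *: 1 + t)) : R^o) - dot (f t) (g t)))
    @ 0^' --> (dot ('D_1 f t) (g t) + dot (f t) ('D_1 g t) : R^o).
  split; first by apply/cvg_ex; eexists; exact: h.
  exact: cvg_lim h.
have -> : (fun h : R => h^-1 *: ((dot (f (h *: 1 + t)) (g (h *: 1 + t)) : R^o) - dot (f t) (g t)))
  = (fun h : R => (dot (h^-1 *: (f (h *: 1 + t) - f t)) (g (h *: 1 + t)) : R^o) +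
     (dot (f t) (h^-1 *: (g (h *: 1 + t) - g t)) : R^o)).
  apply/funext => h.
  by rewrite !dotE /GRing.scale/= -mulrDr addrA subrK.
apply: cvgD; apply: cvg_dot => //.
- have : {for t, continuous g} by apply/differentiable_continuous/derivable1_diffP.
  move=> gc; apply: continuous_cvg => //.
  apply: cvg_within_filter.
  rewrite -{2}[t]add0r -{3}(scale0r (1:R)).
  by apply: cvgD; [exact: cvgZr_tmp|exact: cvg_cst].
- exact: cvg_cst.
Qed.

End Hilbert.

(** The rate survives the passage to the limit in [m]. It serves twice: for the minimizing sequences
    of [riesz], and for the Picard iterates, where it yields continuity of the limit. *)
Lemma geometric_cauchy_cvg {R : realType} {V : completeNormedModType R} (x : nat -> V)
    (c q : R) : 0 <= q < 1 ->
  (forall n m, (n <= m)%N -> `|x n - x m| <= c * q ^+ n) ->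
  exists l, forall n, `|l - x n| <= c * q ^+ n.
Proof.
move=> /andP[q0 q1] xnm.
have cq : c * q ^+ n @[n --> \oo] --> 0.
  rewrite -(mulr0 c); apply: cvgMr.
  by apply: cvg_expr; rewrite ger0_norm.
have /cauchy_cvg/cvg_ex[l xl] : cauchy (x @ \oo).
  apply/cauchy_exP => e e0.
  have [N _ /(_ N (leqnn _)) hN] : \forall n \near \oo, c * q ^+ n < e.
    exact: (cvgr_lt _ cq).
  exists (x N); exists N => // n /= Nn; rewrite /= -ball_normE /=.
  exact: le_lt_trans (xnm _ _ Nn) hN.
exists l => n; apply: (@cvgr_to_le _ \oo _ _ (fun m => `|x m - x n|)).
- by apply: cvg_norm; apply: cvgB => //; exact: cvg_cst.
- by exists n => // m /= nm; rewrite distrC xnm.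
Qed.

Section Riesz.
Context {R : realType} {H : completeNormedModType R}.
Variable dot : {dot H for (@idfun R)}.
Hypothesis dot_norm : forall u : H, `|u| ^+ 2 = dot u u.

(* [phi] is represented by the minimizer of [v |-> |v|^2/2 - phi v]: minimizing
   sequences are Cauchy by the parallelogram law. *)
Lemma riesz (phi : H -> R) (M : R) :
  (forall k u v, phi (k *: u + v) = k * phi u + phi v) ->
  (forall u, `|phi u| <= M * `|u|) ->
  exists g, forall v, phi v = dot g v.
Proof.
move=> phiL phiM.
have phiD u v : phi (u + v) = phi u + phi v by rewrite -{1}(scale1r u) phiL mul1r.
have phi0 : phi 0 = 0 by have := phiD 0 0; rewrite addr0 => h; lra.
have phiZ k u : phi (k *: u) = k * phi u by rewrite -{1}(addr0 (k *: u)) phiL phi0 addr0.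
pose J u := 2^-1 * `|u| ^+ 2 - phi u.
have JlbE : has_inf (range J).
  split; first by exists (J 0), 0.
  exists (- (2^-1 * M ^+ 2)) => _ [u _ <-]; rewrite /J.
  have := phiM u; rewrite ler_norml => /andP[_ h].
  by have := sqr_ge0 (`|u| - M); rewrite -subr_ge0; nra.
set j := inf (range J).
have jJ u : j <= J u by apply: ge_inf; [case: JlbE|exists u].
(* By the midpoint identity [par] below, [8^-1 * |x n - x m|^2] is at most the mean excess of [J]
   over [j]; for [n <= m] this tolerance yields [|x n - x m| <= 2^-1 ^+ n]. *)
have ex n : exists u, J u < j + 8^-1 * (2^-1 ^+ n) ^+ 2.
  have [|_ [u _ <-] h] := @inf_adherent _ _ (8^-1 * (2^-1 ^+ n) ^+ 2) _ JlbE.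
    by rewrite mulr_gt0// exprn_gt0// exprn_gt0.
  by exists u.
have {ex}[x xJ] := choice ex.
have [||g hg] := @geometric_cauchy_cvg R H x 1 2^-1.
- by lra.
- move=> n m nm; rewrite mul1r -(@ler_pXn2r _ 2) ?nnegrE ?exprn_ge0//.
  have hm : 2^-1 ^+ m <= 2^-1 ^+ n :> R by rewrite ler_wiXn2l//; lra.
  have m0 : 0 <= 2^-1 ^+ m :> R by rewrite exprn_ge0.
  have mid := jJ (2^-1 *: (x n + x m)).
  have par : J (2^-1 *: (x n + x m)) = 2^-1 * (J (x n) + J (x m)) - 8^-1 * `|x n - x m| ^+ 2.
    rewrite /J phiZ phiD !dot_norm !(dotE dot) (dotC dot (x m) (x n)); lra.
  have := xJ n; have := xJ m.
  move: (2^-1 ^+ m) (2^-1 ^+ n) hm m0 => a b ab a0 h1 h2; nra.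
exists g => v; apply/eqP; rewrite -subr_eq0; apply/eqP.
have xg : x n @[n --> \oo] --> g.
  apply/cvgrPdist_le => e e0.
  have : 2^-1 ^+ n @[n --> \oo] --> (0 : R) by apply: cvg_expr; rewrite ger0_norm//; lra.
  move=> /(cvgr_lt _)/(_ _ e0); apply: filterS => n /ltW.
  by apply: le_trans; rewrite -[leRHS]mul1r.
(* Optimality of [g], as the limit in [n] of [J (x n) - tolerance < j <= J (x n + t *: v)]. *)
have key t : 0 <= 2^-1 * t ^+ 2 * `|v| ^+ 2 + t * (dot g v - phi v).
  have h1 : 8^-1 * (2^-1 ^+ n) ^+ 2 + (2^-1 * t ^+ 2 * `|v| ^+ 2 + t * (dot (x n) v - phi v))
     @[n --> \oo] --> (8^-1 * 0 ^+ 2 + (2^-1 * t ^+ 2 * `|v| ^+ 2 + t * (dot g v - phi v)) : R^o).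
    apply: cvgD; first apply: cvgMr.
      rewrite expr2; under eq_fun do rewrite expr2.
      by apply: cvgM; apply: cvg_expr; rewrite ger0_norm//; lra.
    apply: cvgD; first exact: cvg_cst.
    apply: cvgMr; apply: cvgB; last exact: cvg_cst.
    by apply: cvg_dot => //; exact: cvg_cst.
  rewrite expr0n/= mulr0 add0r in h1.
  apply: (cvgr_to_ge h1); apply: nearW => n.
  have := jJ (x n + t *: v); have := xJ n.
  by rewrite /J phiD phiZ (normD2 dot_norm) dotZr normrZ exprMn real_normK ?num_real//; lra.
set d := dot g v - phi v in key *.
have a0 := sqr_ge0 `|v|.
(* The [+ 1] keeps the denominator nonzero for [v = 0]. At this [t] the quadratic is minus a square
   times a positive factor, which forces [d = 0]. *)
have := key (- d / (`|v| ^+ 2 + 1)); set a := `|v| ^+ 2 in a0 *.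
have -> : 2^-1 * (- d / (a + 1)) ^+ 2 * a + - d / (a + 1) * d =
   - (d / (a + 1)) ^+ 2 * (2^-1 * a + 1) by field; lra.
rewrite mulNr oppr_ge0 => h.
have : (d / (a + 1)) ^+ 2 * (2^-1 * a + 1) = 0.
  by apply/eqP; rewrite eq_le h mulr_ge0 ?sqr_ge0//; lra.
move/eqP; rewrite mulf_eq0 sqrf_eq0 mulf_eq0 invr_eq0 => /orP[/orP[/eqP|/eqP]|/eqP]; rewrite /d; lra.
Qed.

End Riesz.

Lemma is_derive_scalel {R : realType} {V : normedModType R} (k : R -> R) (t : R) dk (w : V) :
  is_derive t 1 k dk -> is_derive t 1 (fun s => k s *: w) (dk *: w).
Proof.
move=> [kd <-].
suff h : h^-1 *: (k (h *: 1 + t) *: w - k t *: w) @[h --> (0:R)^'] --> 'D_1 k t *: w.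
  by split; [apply/cvg_ex; eexists; exact: h|exact: cvg_lim h].
under eq_fun do rewrite -scalerBl scalerA.
exact: cvgZr_tmp.
Qed.

Section Gradient.
Context {R : realType} {H : completeNormedModType R}.
Variable dot : {dot H for (@idfun R)}.
Hypothesis dot_norm : forall u : H, `|u| ^+ 2 = dot u u.

Lemma continuous_linear_bound (phi : {linear H -> R^o}) : continuous phi ->
  exists M, forall u, `|phi u| <= M * `|u|.
Proof.
move=> /linear_bounded_continuous/linear_boundedP/pinfty_ex_gt0[M _ hM].
by exists M.
Qed.

(** Continuity bounds the differential, so Riesz makes the set in [gradient] nonempty and [get] does
    not fall back on its default. *)
Lemma gradientE (f : H -> R) x v : differentiable f x ->
  'd f x v = dot (gradient dot f x) v.
Proof.
move=> fx; rewrite /gradient.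
have [M hM] := continuous_linear_bound (diff_continuous fx).
have [|g hg] := @riesz R H dot dot_norm ('d f x) M _ hM.
  by move=> k u w; rewrite linearP.
have [|_ ->//] := @getPex _ [set g : H | differentiable f x /\ forall v, 'd f x v = dot g v].
by exists g.
Qed.

Lemma is_derive_comp_gradient (f : H -> R) (x : R -> H) (t : R) v :
  differentiable f (x t) -> is_derive t 1 x v ->
  is_derive t 1 (fun s => f (x s) : R^o) (dot (gradient dot f (x t)) v).
Proof.
move=> fd [xd <-].
have xd' : differentiable x t by apply/derivable1_diffP.
have cd : differentiable (fun s => f (x s) : R^o) t by exact: (differentiable_comp xd' fd).
apply: DeriveDef; first by apply/derivable1_diffP.
rewrite deriveE// (@diff_comp _ _ _ _ x f)//= gradientE//.
by rewrite -deriveE.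
Qed.

(** One-sided on purpose: convexity and minimality along a segment only control increments with [s]
    in [0, 1]. *)
Lemma gradient_at_right (f : H -> R) (x w : H) : differentiable f x ->
  s^-1 * (f (x + s *: w) - f x) @[s --> 0^'+] --> dot (gradient dot f x) w.
Proof.
move=> fd.
have [cd <-] : is_derive (0 : R) 1 (fun s : R => f (x + s *: w) : R^o)
    (dot (gradient dot f x) w).
  have xE : x = x + 0 *: w by rewrite scale0r addr0.
  rewrite [X in gradient _ _ X]xE.
  apply: (@is_derive_comp_gradient f (fun s => x + s *: w)); first by rewrite -xE.
  rewrite -[X in is_derive _ _ _ X]add0r; apply: is_deriveD.
  rewrite -[X in is_derive _ _ _ X]scale1r; exact: is_derive_scalel.
have : h^-1 *: ((f (x + (h *: 1 + 0) *: w) : R^o) - f (x + 0 *: w)) @[h --> 0^'+]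
    --> 'D_1 (fun s : R => f (x + s *: w) : R^o) 0.
  exact: cvg_dnbhs_at_right.
rewrite scale0r addr0; set g := (X in X @ _ --> _ -> _); set k := (X in _ -> X @ _ --> _).
suff -> : g = k by [].
by apply/funext => s; rewrite /g /k addr0 [_ *: 1]mulr1.
Qed.

Lemma convex_function_segment (f : H -> R) x y (s : R) :
  convex_function [set: H] f -> 0 <= s <= 1 ->
  f (x + s *: (y - x)) <= f x + s * (f y - f x).
Proof.
move=> fc /andP[s0 s1].
have := fc (Itv01 s0 s1) y x; rewrite !inE => /(_ I I) h.
have {h} : f (s *: y + (1 - s) *: x) <= s * f y + (1 - s) * f x by exact: h.
have -> : s *: y + (1 - s) *: x = x + s *: (y - x).
  by rewrite scalerBl scale1r scalerBr addrCA.
by move=> h; lra.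
Qed.

Lemma convex_gradient_le (f : H -> R) x y :
  convex_function [set: H] f -> differentiable f x ->
  f x + dot (gradient dot f x) (y - x) <= f y.
Proof.
move=> fc fd; rewrite addrC -lerBrDr.
have h := @gradient_at_right f x (y - x) fd; apply: (cvgr_to_le h) => {h}.
near=> s.
have s0 : 0 < s by [].
have s1 : s <= 1 by near: s; exact: nbhs_right_le.
rewrite ler_pdivrMl// lerBlDl convex_function_segment//.
by rewrite ltW.
Unshelve. all: by end_near. Qed.

Lemma argmin_on_gradient (A : set H) (f : H -> R) x y :
  (forall s, 0 <= s <= 1 -> A (x + s *: (y - x))) ->
  differentiable f x -> argmin_on A f x -> 0 <= dot (gradient dot f x) (y - x).
Proof.
move=> Axy fd [_ fx].
have h := @gradient_at_right f x (y - x) fd; apply: (cvgr_to_ge h) => {h}.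
near=> s.
have s0 : 0 < s by [].
have s1 : s <= 1 by near: s; exact: nbhs_right_le.
rewrite mulr_ge0 ?invr_ge0 ?(ltW s0)// subr_ge0 fx//.
by apply: Axy; rewrite ltW.
Unshelve. all: by end_near. Qed.

End Gradient.

(** * Derivatives and primitives *)

Section RealDerivatives.
Context {R : realType}.
Implicit Types (f df : R -> R) (a b t : R).

Lemma is_derive_continuous (V : normedModType R) (f : R -> V) t (df : V) :
  is_derive t 1 f df -> {for t, continuous f}.
Proof.
by move=> [fd _]; exact/differentiable_continuous/derivable1_diffP.
Qed.

Lemma is_derive_mvt f df a b : a <= b ->
  (forall t, a <= t <= b -> is_derive t 1 f (df t)) ->
  exists2 c, a <= c <= b & f b - f a = df c * (b - a).
Proof.
move=> ab fd.
have [||c cab ->] := @MVT_segment R f df a b ab.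
- by move=> t; rewrite in_itv/= => /andP[/ltW ta /ltW tb]; apply: fd; rewrite ta.
- apply: derivable_within_continuous => t; rewrite in_itv/= => /fd[]//.
by exists c.
Qed.

Lemma is_derive_le0 f df a b : a <= b ->
  (forall t, a <= t <= b -> is_derive t 1 f (df t)) ->
  (forall t, a <= t <= b -> df t <= 0) -> f b <= f a.
Proof.
move=> ab fd df0; have [c /df0 cab h] := is_derive_mvt ab fd.
by rewrite -subr_le0 h mulr_le0_ge0// subr_ge0.
Qed.

Lemma nonincreasing_lb_cvg f a m :
  (forall s t, a <= s -> s <= t -> f t <= f s) -> (forall t, a <= t -> m <= f t) ->
  exists2 l, f t @[t --> +oo] --> l & forall t, a <= t -> l <= f t.
Proof.
move=> fni fm.
pose g t := - f (Num.max a t).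
have gnd : {homo g : s t / s <= t}.
  move=> s t st; rewrite lerN2; apply: fni; first by rewrite le_max lexx.
  by rewrite ge_max !le_max lexx st orbT.
have gub : has_ubound (range g).
  by exists (- m) => _ [t _ <-]; rewrite lerN2 fm// le_max lexx.
have := nondecreasing_cvgr gnd gub.
set l := sup _ => gl; exists (- l).
  have : - g t @[t --> +oo] --> - l by exact: cvgN.
  apply: cvg_trans; apply: near_eq_cvg; near=> t.
  by rewrite /g opprK max_r.
move=> t at_; rewrite lerNl; apply: ub_le_sup => //.
by exists t => //; rewrite /g max_r.
Unshelve. all: by end_near. Qed.

Lemma continuous_integrable_itv f a b : continuous f ->
  lebesgue_measure.-integrable `[a, b] (EFin \o f).
Proof.
move=> fc; apply: continuous_compact_integrable; first exact: segment_compact.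
exact: continuous_subspaceT.
Qed.

Lemma antiderivative f a : continuous f ->
  exists F, forall t, a < t -> is_derive t 1 F (f t).
Proof.
move=> fc; exists (fun x => \int[lebesgue_measure]_(t in `[a, x]) f t)%R => t at_.
have [||] := @continuous_FTC1_closed R f a t (t + 1) _ _ at_ (fc t).
- by rewrite ltrDl.
- exact: continuous_integrable_itv.
by move=> Fd F'E; split; [exact: Fd|rewrite -derive1E; exact: F'E].
Qed.

(** The last two clauses link [F] to the integral over the half-line in both directions: a finite
    integral bounds [F], for (H2), and an infinite one makes it unbounded, for (H1). *)
Lemma ge0_antiderivative f : continuous f -> (forall t, 0 <= f t) ->
  let I := (\int[lebesgue_measure]_(t in `[0%R, +oo[) (f t)%:E)%E in
  exists F, [/\ forall t, 0 < t -> is_derive t 1 F (f t),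
    forall t, 0 <= F t, forall t, ((F t)%:E <= I)%E &
    forall M, (forall t, 0 < t -> F t <= M) -> (I <= M%:E)%E].
Proof.
move=> fc f0 I.
pose F x := (\int[lebesgue_measure]_(t in `[0%R, x]) f t)%R.
have FE x : (F x)%:E = (\int[lebesgue_measure]_(t in `[0%R, x]) (f t)%:E)%E.
  by rewrite fineK//; apply: integrable_fin_num => //; exact: continuous_integrable_itv.
have mf (D : set (measurableTypeR R)) : measurable_fun D (EFin \o (f : measurableTypeR R -> R)).
  apply/measurable_EFinP; apply: measurable_funTS.
  exact: continuous_measurable_fun.
exists F; split.
- move=> t t0.
  have [||] := @continuous_FTC1_closed R f 0 t (t + 1) _ _ t0 (fc t).
  + by rewrite ltrDl.
  + exact: continuous_integrable_itv.
  by move=> Fd F'E; split; [exact: Fd|rewrite -derive1E; exact: F'E].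
- by move=> t; apply: Rintegral_ge0.
- move=> t; rewrite FE; apply: ge0_subset_integral => //=.
  + by move=> s _; rewrite lee_fin.
  + by apply: subset_itvl; rewrite bnd_simp.
move=> M FM.
have := @ge0_nondecreasing_set_cvg_integral _ (measurableTypeR R) R
  (fun n => `[0%R, 0 + n%:R]%classic) (EFin \o (f : measurableTypeR R -> R)) lebesgue_measure.
rewrite -itv_bndy_bigcup_BRight => h.
apply: (cvge_to_le (h _ _ _ _)).
- move=> n m nm; apply/subsetPset; apply: subset_itvl.
  by rewrite bnd_simp lerD2l ler_nat.
- by [].
- by move=> n; exact: mf.
- by move=> n x _; rewrite lee_fin.
- near=> n; rewrite -FE lee_fin FM// add0r ltr0n.
  by near: n; exact: nbhs_infty_gt.
Unshelve. all: by end_near. Qed.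

End RealDerivatives.

Lemma is_derive0_cst {R : realType} (f : R -> R) (a s t : R) :
  (forall u, a < u -> is_derive u 1 f 0) -> a < s -> a < t -> f s = f t.
Proof.
move=> fd; wlog st : s t / s <= t => [h sa ta|sa ta].
  by case: (leP s t) => [|/ltW] /h; [exact|move=> ->].
have [|c _ h] := @is_derive_mvt R f (fun=> 0) s t st.
  by move=> u /andP[su _]; apply: fd; exact: lt_le_trans sa su.
by move: h; rewrite mul0r => /eqP; rewrite subr_eq0 => /eqP.
Qed.

Lemma is_derive_eps {R : realType} {V : normedModType R} (f : R -> V) (t : R) (df : V) :
  (forall e, 0 < e -> \forall s \near t, `|f s - f t - (s - t) *: df| <= e * `|s - t|) ->
  is_derive t 1 f df.
Proof.
move=> fe.
suff h : h^-1 *: (f (h *: 1 + t) - f t) @[h --> (0:R)^'] --> df.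
  by split; [apply/cvg_ex; eexists; exact: h|exact: cvg_lim h].
apply/cvgrPdist_le => e e0.
have [d /= d0 hd] := fe _ e0.
near=> h.
have h0 : h != 0 by near: h; exact: nbhs_dnbhs_neq.
have hd' : `|h| < d by near: h; apply: dnbhs0_lt.
have : `|f (h + t) - f t - (h + t - t) *: df| <= e * `|h + t - t|.
  by apply: hd; rewrite /= opprD addrCA subrr addr0 normrN.
rewrite addrK [h *: 1]mulr1 => hle.
rewrite -[df](scalerK h0) -scalerBr normrZ normfV ler_pdivrMl ?normr_gt0// mulrC.
by rewrite distrC.
Unshelve. all: by end_near. Qed.

(** * Mean value inequality and primitives for vector-valued functions *)

Section VectorCalculus.
Context {R : realType} {H : completeNormedModType R}.
Variable dot : {dot H for (@idfun R)}.
Hypothesis dot_norm : forall u : H, `|u| ^+ 2 = dot u u.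

Lemma norm_le_of_dot (u : H) (c : R) : 0 <= c -> dot u u <= c * `|u| -> `|u| <= c.
Proof.
move=> c0; rewrite -dot_norm => h.
have [->|u0] := eqVneq u 0; first by rewrite normr0.
by move: h; rewrite expr2 ler_pM2r// normr_gt0.
Qed.

Lemma is_derive_dotl (f : R -> H) (t : R) df v : is_derive t 1 f df ->
  is_derive t 1 (fun s => dot (f s) v : R^o) (dot df v).
Proof.
move=> fd; have := is_derive_dot dot_norm fd (is_derive_cst v t 1).
by rewrite dot0r addr0.
Qed.

(** A vector function has no mean value equality. Pairing with the fixed increment [e = f b - f a]
    makes [dot (f t) e - g t * |e|] a nonincreasing scalar function, by Cauchy-Schwarz. *)
Lemma norm_increment_le (f df : R -> H) (g dg : R -> R) (a b : R) : a <= b ->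
  (forall t, a <= t <= b -> is_derive t 1 f (df t)) ->
  (forall t, a <= t <= b -> is_derive t 1 g (dg t)) ->
  (forall t, a <= t <= b -> `|df t| <= dg t) ->
  `|f b - f a| <= g b - g a.
Proof.
move=> ab fd gd fg.
have g0 : 0 <= g b - g a.
  have [c /[dup] cab /fg h ->] := is_derive_mvt ab gd.
  by rewrite mulr_ge0 ?subr_ge0// (le_trans _ h).
apply: norm_le_of_dot => //.
set e := f b - f a.
pose k t := dot (f t) e - g t * `|e|.
have kd t : a <= t <= b -> is_derive t 1 k (dot (df t) e - dg t * `|e|).
  move=> tab; apply: is_deriveB; first exact/is_derive_dotl/fd.
  have := @is_derive_scalel R R^o g t (dg t) (`|e|) (gd t tab).
  exact.
have : k b <= k a.
  apply: (is_derive_le0 ab kd) => t tab; rewrite subr_le0.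
  by rewrite (le_trans (dot_le dot_norm _ _))// ler_wpM2r// fg.
have -> : dot e e = dot (f b) e - dot (f a) e by rewrite -dotBl.
by rewrite /k; lra.
Qed.

(* There is no vector-valued integral here: the primitive at [t] is the Riesz
   representative of the integrals of the scalar functions [dot (f s) v]. *)
Lemma vector_antiderivative (f : R -> H) (a c : R) : continuous f -> a < c ->
  exists F, F c = 0 /\ forall t, a < t -> is_derive t 1 F (f t).
Proof.
move=> fc ac.
have dfc v : continuous (fun t => dot (f t) v).
  move=> t; apply: (@cvg_dot _ _ dot dot_norm); first exact: fc.
  exact: cvg_cst.
have [G GE] := choice (fun v => antiderivative a (dfc v)).
pose phi t v := G v t - G v c.
have mvt v s t : a < s -> a < t -> exists2 z, `|z - t| <= `|s - t| &
    G v s - G v t = (s - t) * dot (f z) v.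
  move=> sa ta; have [st|/ltW ts] := leP s t.
    have [|z /andP[sz zt] hz] := @is_derive_mvt R (G v) (fun t => dot (f t) v) s t st.
      by move=> u /andP[su _]; apply: GE; exact: lt_le_trans sa su.
    exists z; first by rewrite !ler0_norm ?subr_le0//; lra.
    by lra.
  have [|z /andP[sz zt] hz] := @is_derive_mvt R (G v) (fun t => dot (f t) v) t s ts.
    by move=> u /andP[su _]; apply: GE; exact: lt_le_trans ta su.
  exists z; first by rewrite !ger0_norm ?subr_ge0//; lra.
  by rewrite hz mulrC.
have phi_lin t k u v : a < t -> phi t (k *: u + v) = k * phi t u + phi t v.
  move=> ta.
  pose D s := G (k *: u + v) s - k *: (G u s : R^o) - G v s.
  have Dd s : a < s -> is_derive s 1 D 0.
    move=> sa; have -> : 0 = dot (f s) (k *: u + v) - k *: (dot (f s) u : R^o) - dot (f s) v.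
      by rewrite dotDr dotZr /GRing.scale/=; ring.
    by apply: is_deriveB; [apply: is_deriveB; [|apply: is_deriveZ]|]; exact: GE.
  by have := is_derive0_cst Dd ta ac; rewrite /D /phi /GRing.scale/=; lra.
(* The maximum of the norm of [f] is taken over the interval of radius [|t - c|] around [c], which
   contains the mean value point whatever [v] is. *)
have phi_bnd t : a < t -> exists M, forall v, `|phi t v| <= M * `|v|.
  move=> ta; have [||z _ hz] := @EVT_max R (fun s => `|f s|) (c - `|t - c|) (c + `|t - c|).
  - by rewrite lerD2l -subr_ge0 opprK addr_ge0.
  - by apply: continuous_subspaceT => s; apply: cvg_norm; exact: fc.
  exists (`|t - c| * `|f z|) => v; rewrite /phi.
  have [y yt ->] := mvt v t c ta ac; rewrite normrM -mulrA ler_wpM2l//.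
  rewrite (le_trans (cauchy_schwarz dot_norm _ _))// ler_wpM2r// hz//.
  by rewrite in_itv/= -ler_distl.
have ex t : exists F, a < t -> forall v, phi t v = dot F v.
  have [ta|] := ltP a t; last by exists 0.
  have [M hM] := phi_bnd t ta.
  by have [F hF] := @riesz R H dot dot_norm (phi t) M (fun k u v => phi_lin t k u v ta) hM; exists F.
have [F FE] := choice ex.
exists F; split.
  by apply: dot_ext => // v; rewrite -FE// /phi subrr dot0l.
move=> t ta; apply: is_derive_eps => e e0.
have /cvgrPdist_le/(_ _ e0) [d /= d0 hd] := fc t.
near=> s.
have sa : a < s by near: s; exact: lt_nbhsr.
have sd : `|s - t| < d by rewrite distrC; near: s; exists d.
(* The mean value point depends on the direction, so the remainder is tested against itself: the
   scalar mean value formula for [G w] bounds [dot w w] by [e * |s - t| * |w|]. *)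
set w := F s - F t - _.
apply: norm_le_of_dot; first by rewrite mulr_ge0// ltW.
have [z zt hz] := mvt w s t sa ta.
rewrite {1}/w !dotBl dotZl -!FE// /phi.
have -> : G w s - G w c - (G w t - G w c) - (s - t) * dot (f t) w =
  - ((s - t) * dot (f t - f z) w) by rewrite dotBl; lra.
rewrite -mulrN -dotNl (le_trans (ler_norm _))// normrM.
rewrite (mulrC e) -mulrA ler_wpM2l//.
rewrite (le_trans (cauchy_schwarz dot_norm _ _))// ler_wpM2r// normrN.
by apply: hd; rewrite /= distrC; exact: le_lt_trans zt sd.
Unshelve. all: by end_near. Qed.

End VectorCalculus.

Lemma is_derive_expR_affine {R : realType} (c l a t : R) :
  is_derive t 1 (fun s => c * expR (l * (s - a))) (c * l * expR (l * (t - a))).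
Proof.
have d1 : is_derive t 1 (fun s => l * (s - a)) l.
  have h := is_deriveB (is_derive_id t 1) (is_derive_cst a t 1).
  by have := is_deriveZ l h; rewrite subr0 /GRing.scale/= mulr1.
have d2 := @is_derive1_comp R expR (fun s => l * (s - a)) t _ _ (is_derive_expR _) d1.
by have := is_deriveZ c d2; rewrite /GRing.scale/= mulrCA mulrC -mulrA.
Qed.

(** * Second-order differential equations *)

Section SecondOrderODE.
Context {R : realType} {H : completeNormedModType R}.
Variable dot : {dot H for (@idfun R)}.
Hypothesis dot_norm : forall u : H, `|u| ^+ 2 = dot u u.
Variables (F : R -> H -> H -> H) (K : R).
Hypothesis K0 : 0 <= K.
Hypothesis F_lip : forall t x y u v,
  `|F t x u - F t y v| <= K * (`|x - y| + `|u - v|).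

Lemma ode2_unique (x u p y v q : R -> H) (a b : R) : a <= b ->
  (forall t, a <= t <= b -> [/\ is_derive t 1 x (u t), is_derive t 1 u (p t) &
     p t = F t (x t) (u t)]) ->
  (forall t, a <= t <= b -> [/\ is_derive t 1 y (v t), is_derive t 1 v (q t) &
     q t = F t (y t) (v t)]) ->
  x a = y a -> u a = v a -> x b = y b /\ u b = v b.
Proof.
move=> ab xs ys xya uva.
pose e t := dot (x t - y t) (x t - y t) + dot (u t - v t) (u t - v t).
(* Gronwall rate: with [X], [U] the norms of the two differences, the derivative of [e] is at most
   [2 X U + 2 K (X + U) U <= (1 + 3 K) (X^2 + U^2)]. *)
pose l := 1 + 3 * K.
have ed t : a <= t <= b -> is_derive t 1 e
    ((dot (u t - v t) (x t - y t) + dot (x t - y t) (u t - v t)) +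
     (dot (p t - q t) (u t - v t) + dot (u t - v t) (p t - q t))).
  move=> tab; have [xd ud _] := xs t tab; have [yd vd _] := ys t tab.
  by apply: is_deriveD; apply: is_derive_dot => //; exact: is_deriveB.
have kd t (tab : a <= t <= b) := is_deriveM (ed t tab) (is_derive_expR_affine 1 (- l) a t).
have eb : e b <= 0.
  have := is_derive_le0 ab kd; rewrite /= -[(e * _) b]/(e b * _) -[(e * _) a]/(e a * _).
  have -> : e a = 0 by rewrite /e xya uva !subrr dot0l addr0.
  rewrite mul0r !mul1r pmulr_lle0 ?expR_gt0//; apply.
  move=> t tab; rewrite /GRing.scale/= mul1r mulrA (mulrC _ (expR _)) -mulrDr.
  rewrite pmulr_rle0 ?expR_gt0//.
  have [_ _ pE] := xs t tab; have [_ _ qE] := ys t tab.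
  have := dot_le dot_norm (p t - q t) (u t - v t).
  have := dot_le dot_norm (x t - y t) (u t - v t).
  rewrite (dotC dot (u t - v t) (x t - y t)) (dotC dot (u t - v t) (p t - q t)).
  have := F_lip t (x t) (y t) (u t) (v t); rewrite -pE -qE /e -!dot_norm.
  move: (`|p t - q t|) (normr_ge0 (u t - v t)) => P.
  move: (`|x t - y t|) (`|u t - v t|) (dot _ _) (dot _ _) => X U d1 d2 U0 hP h1 h2.
  have h3 : P * U <= K * (X + U) * U by rewrite ler_wpM2r.
  have h4 : 0 <= K * (X - U) ^+ 2 by rewrite mulr_ge0// sqr_ge0.
  have h5 := sqr_ge0 (X - U).
  have h6 : 0 <= K * X ^+ 2 by rewrite mulr_ge0// sqr_ge0.
  have h7 : 0 <= K * U ^+ 2 by rewrite mulr_ge0// sqr_ge0.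
  rewrite /l; nra.
have : 0 <= `|x b - y b| ^+ 2 by rewrite sqr_ge0.
have : 0 <= `|u b - v b| ^+ 2 by rewrite sqr_ge0.
move: eb; rewrite /e -!dot_norm => eb h1 h2.
have : `|x b - y b| ^+ 2 = 0 by lra.
have : `|u b - v b| ^+ 2 = 0 by lra.
move=> /eqP; rewrite sqrf_eq0 normr_eq0 subr_eq0 => /eqP ->.
by move=> /eqP; rewrite sqrf_eq0 normr_eq0 subr_eq0 => /eqP ->.
Qed.

Hypothesis F_cont : forall x v : R -> H, continuous x -> continuous v ->
  continuous (fun t => F t (x t) (v t)).

Section Picard.
Variables (t0 : R) (x0 v0 : H).

(* Picard iteration on the second derivative, with estimates weighted by
   [expR (l * (t - t0))] so that it contracts on the whole half-line. Everything
   is frozen before [t0] by the clamp [m], to work with functions on [R]. *)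
Let m (t : R) := Num.max t t0.
Let l := 4 * K + 1.
Let weight (t : R) := expR (l * (t - t0)).

Let m_cont : continuous m.
Proof. by move=> t; apply: (continuous_max cvg_id (cvg_cst _)). Qed.

Let m_ge t : t0 <= m t. Proof. by rewrite le_max lexx orbT. Qed.

Let m_id t : t0 <= t -> m t = t. Proof. by move=> ?; rewrite /m max_l. Qed.

Let cont_m (V : normedModType R) (f : R -> V) :
  (forall t, t0 <= t -> {for t, continuous f}) -> continuous (fun t => f (m t)).
Proof.
move=> fc t; apply: (@continuous_comp _ _ _ m f); first exact: m_cont.
by apply: fc; exact: m_ge.
Qed.

Let primitives (w : R -> H) : exists xv : (R -> H) * (R -> H), continuous w ->
  [/\ xv.1 t0 = x0, xv.2 t0 = v0 & forall t, t0 <= t ->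
    is_derive t 1 xv.1 (xv.2 t) /\ is_derive t 1 xv.2 (w t)].
Proof.
(* The pair given to a discontinuous [w] is arbitrary; it makes the operator [J] below total. *)
have [wc|] := pselect (continuous w); last by exists (w, w).
(* [vector_antiderivative] differentiates only strictly after its left bound; [t0 - 1] makes the
   derivatives at [t0] two-sided. *)
have t01 : t0 - 1 < t0 by lra.
have lt1 t : t0 <= t -> t0 - 1 < t by lra.
have [V [V0 Vd]] := vector_antiderivative dot_norm wc t01.
pose v t := v0 + V t.
have vd t : t0 <= t -> is_derive t 1 v (w t).
  move=> tt0; rewrite -[w t]add0r; apply: is_deriveD; exact/Vd/lt1.
have vmc := cont_m (fun t tt0 => is_derive_continuous (vd t tt0)).
have [X [X0 Xd]] := vector_antiderivative dot_norm vmc t01.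
exists (fun t => x0 + X t, v) => _; split => /=.
- by rewrite X0 addr0.
- by rewrite /v V0 addr0.
move=> t tt0; split; last exact: vd.
rewrite -[v t]add0r -{2}(m_id tt0); apply: is_deriveD; exact/Xd/lt1.
Qed.

Let J := projT1 (choice primitives).
Let JP w : continuous w -> [/\ (J w).1 t0 = x0, (J w).2 t0 = v0 &
  forall t, t0 <= t -> is_derive t 1 (J w).1 ((J w).2 t) /\ is_derive t 1 (J w).2 (w t)].
Proof. exact: projT2 (choice primitives) w. Qed.

Let step (w : R -> H) (t : R) : H := F (m t) ((J w).1 (m t)) ((J w).2 (m t)).

Let step_cont w : continuous w -> continuous (step w).
Proof.
move=> /JP[_ _ Jd].
have c1 := cont_m (fun t tt0 => is_derive_continuous (Jd t tt0).1).
have c2 := cont_m (fun t tt0 => is_derive_continuous (Jd t tt0).2).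
have gc := F_cont c1 c2; have gmc := cont_m (fun t _ => gc t).
suff -> : step w = (fun t => F (m t) ((J w).1 (m (m t))) ((J w).2 (m (m t)))) by [].
by apply/funext => t; rewrite /step /= !(m_id (m_ge _)).
Qed.

Let l1 : 1 <= l. Proof. by rewrite lerDr mulr_ge0. Qed.
Let l0 : 0 < l. Proof. exact: lt_le_trans l1. Qed.

(** [D / l * weight] is a primitive of [D * weight], so each integration from [t0] gains a factor
    [1 / l] in the weighted norm. *)
Let weight_increment (f df : R -> H) (D : R) t : t0 <= t -> 0 <= D -> f t0 = 0 ->
  (forall s, t0 <= s -> is_derive s 1 f (df s)) ->
  (forall s, t0 <= s -> `|df s| <= D * weight s) -> `|f t| <= D / l * weight t.
Proof.
move=> tt0 D0 f0 fd dfD.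
have := @norm_increment_le _ _ dot dot_norm f df _ _ _ _ tt0 _
  (fun s _ => is_derive_expR_affine (D / l) l t0 s).
rewrite f0 subr0 => h; apply: (le_trans (h _ _)).
- by move=> s /andP[s0 _]; exact: fd.
- by move=> s /andP[s0 _]; rewrite divfK ?gt_eqF//; exact: dfD.
- by rewrite gerBl mulr_ge0 ?expR_ge0// divr_ge0// ltW.
Qed.

(** Two integrations give [D / l] for velocities and [D / l / l <= D / l] for positions, hence
    [2 K D / l] after [F_lip]; [l = 4 K + 1] makes this at most [D / 2]. *)
Let step_contract w w' D : continuous w -> continuous w' -> 0 <= D ->
  (forall t, t0 <= t -> `|w t - w' t| <= D * weight t) ->
  forall t, t0 <= t -> `|step w t - step w' t| <= D / 2 * weight t.
Proof.
move=> /JP[x1 v1 J1] /JP[x2 v2 J2] D0 ww' t tt0; rewrite /step m_id//.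
have hv s : t0 <= s -> `|(J w).2 s - (J w').2 s| <= D / l * weight s.
  move=> st0; apply: (@weight_increment (fun s => (J w).2 s - (J w').2 s) _ _ _ st0 D0 _ _ ww'); first by rewrite v1 v2 subrr.
  by move=> u ut0; apply: is_deriveB; [case: (J1 u ut0)|case: (J2 u ut0)].
have hx s : t0 <= s -> `|(J w).1 s - (J w').1 s| <= D / l / l * weight s.
  move=> st0; apply: (@weight_increment (fun s => (J w).1 s - (J w').1 s) _ _ _ st0 _ _ _ hv).
    by rewrite divr_ge0// ltW.
    by rewrite x1 x2 subrr.
  by move=> u ut0; apply: is_deriveB; [case: (J1 u ut0)|case: (J2 u ut0)].
apply: (le_trans (F_lip _ _ _ _ _)).
have W0 : 0 <= weight t by rewrite expR_ge0.
apply: (@le_trans _ _ (K * (2 * (D / l * weight t)))).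
  rewrite ler_wpM2l// mulr2n mulrDl !mul1r lerD// ?hv// (le_trans (hx _ tt0))//.
  by rewrite ler_wpM2r// ler_pdivrMr// ler_peMr// divr_ge0// ltW.
rewrite !mulrA ler_wpM2r//.
have -> : K * 2 * D / l = D / 2 * (4 * K / l) by field; rewrite gt_eqF.
rewrite ler_piMr ?divr_ge0// ler_pdivrMr// mul1r; rewrite /l; lra.
Qed.

Lemma ode2_exists (B : R) : (forall t x, `|F t x v0| <= B) ->
  exists x v w : R -> H, [/\ x t0 = x0, v t0 = v0, continuous w &
    forall t, t0 <= t -> [/\ is_derive t 1 x (v t), is_derive t 1 v (w t) &
      w t = F t (x t) (v t)]].
Proof.
move=> FB.
have B0 : 0 <= B := le_trans (normr_ge0 _) (FB 0 0).
pose W n := iter n step (fun=> 0).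
have Wc n : continuous (W n).
  elim: n => [|n IH]; last exact: step_cont.
  by move=> t; exact: cvg_cst.
have Wm n t : W n (m t) = W n t.
  by case: n => //= n; rewrite /step (m_id (m_ge t)).
(* [W 0] is the zero acceleration, so its velocity stays [v0] and [W 1] is a value of [F] at
   velocity [v0]: this is what [B] bounds. *)
have W1 t : t0 <= t -> `|W 1%N t - W 0%N t| <= B * weight t.
  move=> tt0; rewrite /= subr0 /step m_id//.
  have [_ u0 ud] := JP (Wc 0%N).
  have hv : `|(J (W 0%N)).2 t - v0| <= 0 / l * weight t.
    apply: (@weight_increment (fun t => (J (W 0%N)).2 t - v0) (fun=> 0)) => //.
    - by rewrite u0 subrr.
    - by move=> s /ud[_ h]; rewrite -[0]subr0; apply: is_deriveB.
    - by move=> s _; rewrite normr0 mul0r.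
  move: hv; rewrite !mul0r normr_le0 subr_eq0 => /eqP ->.
  rewrite (le_trans (FB _ _))// ler_peMr// -expR0 ler_expR mulr_ge0 ?subr_ge0//.
  exact: ltW.
have Wstep n t : t0 <= t -> `|W n.+1 t - W n t| <= B * 2^-1 ^+ n * weight t.
  elim: n t => [|n IH] t tt0; first by rewrite expr0 mulr1; exact: W1.
  rewrite exprSr mulrA; apply: (step_contract (Wc n.+1) (Wc n) _ IH tt0).
  by rewrite mulr_ge0// exprn_ge0.
pose c t := 2 * B * weight (m t).
have c0 t : 0 <= c t by rewrite !mulr_ge0// expR_ge0.
have Wcauchy t n k : (n <= k)%N -> `|W n t - W k t| <= c t * 2^-1 ^+ n.
  (* The telescoping bound with [2^-1 ^+ n - 2^-1 ^+ k] is the one that passes through the induction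
     on [k]. *)
  move=> nk; apply: (@le_trans _ _ (c t * (2^-1 ^+ n - 2^-1 ^+ k))); last first.
    by rewrite ler_wpM2l// gerBl exprn_ge0.
  elim: k nk => [|k IH]; first by rewrite leqn0 => /eqP ->; rewrite !subrr normr0 mulr0.
  rewrite leq_eqVlt => /orP[/eqP ->|]; first by rewrite !subrr normr0 mulr0.
  rewrite ltnS => /IH h.
  have := Wstep k (m t) (m_ge t); rewrite !Wm => h2.
  have := ler_normD (W n t - W k t) (W k t - W k.+1 t).
  rewrite addrA subrK => /le_trans; apply.
  rewrite distrC in h2; apply: (le_trans (lerD h h2)).
  by rewrite /c exprS; lra.
have half : 0 <= (2^-1 : R) < 1 by lra.
have [w hw] := choice (fun t => geometric_cauchy_cvg half (Wcauchy t)).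
have wc : continuous w.
  move=> t; apply/cvgrPdist_le => e e0.
  have e3 : 0 < e / 3 by rewrite divr_gt0.
  (* The weight increases, so its value at [t + 1] controls the distance from [w] to [W N] uniformly
     to the left of [t + 1]. *)
  have [N hN] : exists N, c (t + 1) * 2^-1 ^+ N <= e / 3.
    have : c (t + 1) * 2^-1 ^+ n @[n --> \oo] --> 0.
      rewrite -(mulr0 (c (t + 1))); apply: cvgMr.
      by apply: cvg_expr; rewrite ger0_norm//; lra.
    move=> /(cvgr_le _)/(_ _ e3)[N _ h]; exists N; exact: (h N (leqnn N)).
  have := Wc N t => /cvgrPdist_le/(_ _ e3) hs.
  have hwN s : s <= t + 1 -> `|w s - W N s| <= e / 3.
    move=> st; apply: (le_trans (hw s N)); apply: le_trans hN.
    rewrite ler_wpM2r ?exprn_ge0// ler_wpM2l ?mulr_ge0// ler_expR ler_wpM2l ?(ltW l0)//.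
    by rewrite lerD2r ge_max !le_max st lexx orbT.
  have t1 : (t : R) < t + 1 by rewrite ltrDl.
  have ht := lt_nbhsl t1.
  near=> s.
  have st : s <= t + 1 by apply: ltW; near: s.
  have h1 : `|W N t - W N s| <= e / 3 by near: s.
  have h2 := hwN t (ler_wpDr ler01 (lexx t)).
  have h3 := hwN s st.
  have -> : w t - w s = (w t - W N t) + ((W N t - W N s) - (w s - W N s)).
    by rewrite opprB !subrKA.
  apply: (le_trans (ler_normD _ _)); apply: (le_trans (lerD (lexx _) (ler_normB _ _))).
  lra.
have wfix t : t0 <= t -> w t = step w t.
  move=> tt0; apply/eqP; rewrite -subr_eq0 -normr_le0.
  have : c t * 2^-1 ^+ n @[n --> \oo] --> 0.
    rewrite -(mulr0 (c t)); apply: cvgMr.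
    by apply: cvg_expr; rewrite ger0_norm//; lra.
  move=> h; apply: (cvgr_to_ge h); apply: nearW => n {h}.
  have h1 := hw t n.+1.
  have h2 : `|step (W n) t - step w t| <= 2 * B * 2^-1 ^+ n / 2 * weight t.
    apply: (step_contract (Wc n) wc _ _ tt0); first by rewrite !mulr_ge0// exprn_ge0.
    by move=> s st0; rewrite distrC (le_trans (hw s n))// /c m_id// mulrAC.
  have := ler_normD (w t - W n.+1 t) (W n.+1 t - step w t).
  rewrite addrA subrK => /le_trans; apply; apply: (le_trans (lerD h1 h2)).
  by rewrite /c exprS m_id//; lra.
have [x1 v1 wd] := JP wc.
exists (J w).1, (J w).2, w; split => // t tt0.
have [xd vd] := wd t tt0; split => //.
by rewrite {1}wfix// /step m_id.
Unshelve. all: by end_near. Qed.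

End Picard.
End SecondOrderODE.

(** * Global existence *)

Section DeriveInTheory.
Context {R : realType} {V : normedModType R}.
Implicit Types (I J : set R) (f g : R -> V) (t : R).

Lemma diff_quotientK f t s : s != t -> (s - t) *: diff_quotient f t s = f s - f t.
Proof. by move=> st; rewrite /diff_quotient scalerA mulfV ?scale1r// subr_eq0. Qed.

Lemma is_derive_diff_quotient f t (df : V) :
  is_derive t 1 f df <-> diff_quotient f t s @[s --> t^'] --> df.
Proof.
split=> [[fd <-]|fq]; last first.
  apply: is_derive_eps => e e0.
  have /cvgrPdist_le/(_ _ e0) := fq; rewrite near_withinE => h.
  near=> s; have [->|st] := eqVneq s t.
    by rewrite !subrr scale0r subr0 !normr0 mulr0.
  have : `|df - diff_quotient f t s| <= e by move: (st); near: s.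
  rewrite -diff_quotientK// -scalerBr normrZ distrC mulrC => hs.
  by rewrite ler_wpM2r.
apply/cvgrPdist_le => e e0.
move: fd => /cvgrPdist_le/(_ _ e0) [d /= d0 hd].
exists d => //= s st ts; have := hd (s - t); rewrite /= add0r normrN distrC subr_eq0.
by move=> /(_ st ts); rewrite /shift/= [_ *: 1]mulr1 subrK.
Unshelve. all: by end_near. Qed.

Lemma within_dnbhs_local I J t : (\forall s \near t, I s <-> J s) ->
  within I t^' = within J t^'.
Proof.
move=> IJ; have {}IJ : \forall s \near t^', I s <-> J s by apply: cvg_within IJ.
apply/predeqP => A; rewrite /within/=.
by split; move: IJ; apply: filterS2 => s [IJ JI] IA; [move/JI|move/IJ]; exact: IA.
Qed.

(** As an equality of image filters, it transfers at once the existence and the value of the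
    relative derivative. *)
Lemma derive_in_local I J f g t : (\forall s \near t, I s <-> J s) ->
  (\forall s \near t, J s -> f s = g s) -> f t = g t ->
  diff_quotient f t @ within I t^' = diff_quotient g t @ within J t^'.
Proof.
move=> /within_dnbhs_local -> fg ft.
have {}fg : \forall s \near t^', J s -> f s = g s by apply: cvg_within fg.
apply/predeqP => A; rewrite /fmap /within/=.
by split; move: fg; apply: filterS2 => s fg JA Js; have := JA Js;
  rewrite /= /diff_quotient ft fg.
Qed.

Lemma derive_in_interior I f t (df : V) : (\forall s \near t, I s) ->
  is_derive t 1 f df <-> derivable_in I f t /\ derive_in I f t = df.
Proof.
move=> It; rewrite is_derive_diff_quotient /derivable_in /derive_in.
have -> : within I t^' = t^'.
  rewrite (@within_dnbhs_local I setT); last by apply: filterS It.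
  by apply/predeqP => A; rewrite /within/=; split; apply: filterS => s // /(_ Logic.I).
split => [h|[/cvg_ex[l h] <-]]; last by rewrite (cvg_lim _ h).
split; last exact: cvg_lim h.
by apply/cvg_ex; exists df.
Qed.

Lemma derivable_in_continuous I f t : I t -> derivable_in I f t ->
  f @ within I (nbhs t) --> f t.
Proof.
move=> It /cvg_ex[l fl].
apply/cvgrPdist_le => e e0.
have M0 : 0 < `|l| + 1 by rewrite ltr_wpDl.
have /cvgrPdist_le/(_ 1 ltr01) := fl; rewrite !near_withinE => h.
near=> s => Is.
have [->|st] := eqVneq s t; first by rewrite subrr normr0 ltW.
have : `|l - diff_quotient f t s| <= 1 by move: (Is); move: (st); near: s.
have sd : `|s - t| <= e / (`|l| + 1).
  by rewrite distrC; near: s; apply: cvgr_dist_le => //; exact: divr_gt0.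
rewrite (distrC (f t)) -diff_quotientK// normrZ => hq.
have : `|diff_quotient f t s| <= `|l| + 1.
  rewrite -[diff_quotient _ _ _](subrK l) addrC (le_trans (ler_normD _ _))// lerD2l.
  by rewrite distrC.
move=> hq2; apply: le_trans (ler_pM _ _ sd hq2) _ => //.
by rewrite divfK ?gt_eqF.
Unshelve. all: by end_near. Qed.

End DeriveInTheory.

(** * Truncation of the vector field outside a ball *)

Section RadialRetraction.
Context {R : realType} {H : normedModType R}.

Definition radial_retraction (A : R) (u : H) : H := (A / Num.max A `|u|) *: u.

Lemma radial_retraction_id A u : 0 < A -> `|u| <= A -> radial_retraction A u = u.
Proof.
by move=> A0 uA; rewrite /radial_retraction max_l// divff ?scale1r// gt_eqF.
Qed.

Lemma norm_radial_retraction A u : 0 < A -> `|radial_retraction A u| <= A.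
Proof.
move=> A0; have M0 : 0 < Num.max A `|u| by rewrite lt_max A0.
rewrite /radial_retraction normrZ ger0_norm ?divr_ge0 ?(ltW A0) ?(ltW M0)// mulrAC ler_pdivrMr// ler_pM2l//.
by rewrite le_max lexx orbT.
Qed.

(** The difference splits into [(A / a) *: (u - v)] and a multiple of [v], each of norm at most
    [|u - v|]; hence the constant 2, valid in any normed space. *)
Lemma radial_retraction_lip A u v : 0 < A ->
  `|radial_retraction A u - radial_retraction A v| <= 2 * `|u - v|.
Proof.
move=> A0; rewrite /radial_retraction.
set a := Num.max A `|u|; set b := Num.max A `|v|.
have a0 : 0 < a by rewrite lt_max A0.
have b0 : 0 < b by rewrite lt_max A0.
have -> : (A / a) *: u - (A / b) *: v = (A / a) *: (u - v) + (A / a - A / b) *: v.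
  by rewrite scalerBr scalerBl addrA subrK.
rewrite (le_trans (ler_normD _ _))// mulr2n mulrDl mul1r lerD// normrZ.
  rewrite ger0_norm ?divr_ge0 ?(ltW A0) ?(ltW a0)// ler_piMl//.
  by rewrite ler_pdivrMr// mul1r le_max lexx.
have -> : A / a - A / b = A / a * ((b - a) / b).
  by field; rewrite !gt_eqF.
have ba : `|b - a| <= `|u - v|.
  apply: le_trans (ler_dist_dist u v); rewrite distrC /a /b.
  move: (`|u|) (`|v|) => p q; have := ler_norm (p - q); have := ler_norm (q - p).
  rewrite (distrC q p); case: (leP A p) => ?; case: (leP A q) => ?; rewrite ler_norml; lra.
have vb : `|v| / b <= 1 by rewrite ler_pdivrMr// mul1r le_max lexx orbT.
have Aa : A / a <= 1 by rewrite ler_pdivrMr// mul1r le_max lexx.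
rewrite !normrM !normfV (gtr0_norm b0) (gtr0_norm A0) (gtr0_norm a0) -!mulrA.
have vb0 : 0 <= `|v| / b by rewrite divr_ge0// ltW.
have Aa0 : 0 <= A / a by rewrite divr_ge0// ltW.
rewrite (mulrC b^-1) mulrA -[leRHS]mul1r; apply: ler_pM => //; first exact: mulr_ge0.
by rewrite -[leRHS]mulr1 ler_pM.
Qed.

End RadialRetraction.

Section Lipschitz.
Context {R : realType} {V W : normedModType R}.

Lemma lipschitz_continuous (f : V -> W) (k : R) :
  (forall u v, `|f u - f v| <= k * `|u - v|) -> continuous f.
Proof.
move=> fk u; apply/cvgrPdist_le => e e0; near=> v.
have k1 : 0 < `|k| + 1 by rewrite ltr_wpDl.
apply: (le_trans (fk u v)); apply: (@le_trans _ _ ((`|k| + 1) * `|u - v|)).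
  by rewrite ler_wpM2r// (le_trans (ler_norm k))// lerDl.
rewrite -ler_pdivlMl// mulrC; near: v; apply: cvgr_dist_le => //.
by rewrite divr_gt0.
Unshelve. all: by end_near. Qed.

Lemma lipschitz_on_bounded_ball (f : V -> W) (A : R) : lipschitz_on_bounded f ->
  exists2 L, 0 <= L & forall u v, `|u| <= A -> `|v| <= A -> `|f u - f v| <= L * `|u - v|.
Proof.
move=> /(_ [set u | `|u| <= A]) [].
  exists A; split; first exact: num_real.
  by move=> M /ltW AM u /= /le_trans; exact.
move=> M [Mr hM].
exists (`|M| + 1); first by rewrite addr_ge0.
move=> u v uA vA; apply: (hM _ _ (u, v)) => //=.
by rewrite (le_lt_trans (ler_norm M))// ltrDl.
Qed.

End Lipschitz.

Section TruncatedField.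
Context {R : realType} {H : completeNormedModType R}.
Variables (gamma : R) (gPhi gPsi : H -> H) (eps : R -> R) (t0 A : R).
Hypotheses (gamma_ge0 : 0 <= gamma) (A0 : 0 < A).
Hypotheses (Phi_lip : lipschitz_on_bounded gPhi) (Psi_lip : lipschitz_on_bounded gPsi).
Hypothesis eps_cont : forall t, t0 <= t -> {for t, continuous eps}.
Hypothesis eps_bnd : forall t, t0 <= t -> 0 <= eps t <= eps t0.

(** Provides what [ode2_exists] and [ode2_unique] require, while keeping the true field on the ball
    of radius [A] from [t0] on. Only the position is retracted: the friction term is already
    globally Lipschitz in the velocity. *)
Lemma truncated_field : exists (F : R -> H -> H -> H) (K : R), [/\ 0 <= K,
  forall t x y u v, `|F t x u - F t y v| <= K * (`|x - y| + `|u - v|),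
  forall x v : R -> H, continuous x -> continuous v -> continuous (fun t => F t (x t) (v t)),
  forall v0, exists B, forall t x, `|F t x v0| <= B &
  forall t x u, t0 <= t -> `|x| <= A ->
    F t x u = - (gamma *: u + gPhi x + eps t *: gPsi x)].
Proof.
pose P := @radial_retraction R H A.
have [L1 L10 h1] := lipschitz_on_bounded_ball A Phi_lip.
have [L2 L20 h2] := lipschitz_on_bounded_ball A Psi_lip.
have PA u : `|P u| <= A by exact: norm_radial_retraction.
have lip1 u v : `|gPhi (P u) - gPhi (P v)| <= 2 * L1 * `|u - v|.
  rewrite (le_trans (h1 _ _ _ _))// -mulrA mulrCA ler_wpM2l//.
  exact: radial_retraction_lip.
have lip2 u v : `|gPsi (P u) - gPsi (P v)| <= 2 * L2 * `|u - v|.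
  rewrite (le_trans (h2 _ _ _ _))// -mulrA mulrCA ler_wpM2l//.
  exact: radial_retraction_lip.
pose e t := eps (Num.max t t0).
have m0 t : t0 <= Num.max t t0 by rewrite le_max lexx orbT.
have e0 t : 0 <= e t by have /andP[] := eps_bnd (m0 t).
have e1 t : e t <= eps t0 by have /andP[] := eps_bnd (m0 t).
have eps0 : 0 <= eps t0 by rewrite (le_trans (e0 0)).
have ec : continuous e.
  move=> t; apply: (@continuous_comp _ _ _ (fun t => Num.max t t0) eps).
    exact: (continuous_max cvg_id (cvg_cst _)).
  exact: eps_cont (m0 t).
exists (fun t x u => - (gamma *: u + gPhi (P x) + e t *: gPsi (P x))).
exists (gamma + 2 * L1 + eps t0 * (2 * L2)); split.
- by rewrite !addr_ge0 ?mulr_ge0.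
- move=> t x y u v.
  have -> : - (gamma *: u + gPhi (P x) + e t *: gPsi (P x)) - - (gamma *: v + gPhi (P y) + e t *: gPsi (P y))
    = - (gamma *: (u - v) + (gPhi (P x) - gPhi (P y)) + e t *: (gPsi (P x) - gPsi (P y))).
    by rewrite -opprD !scalerBr; congr (- _); rewrite opprD addrACA opprD; congr (_ + _); rewrite addrACA.
  rewrite normrN (le_trans (ler_normD _ _))//.
  have a1 := ler_normD (gamma *: (u - v)) (gPhi (P x) - gPhi (P y)).
  rewrite normrZ (ger0_norm gamma_ge0) in a1.
  have a2 := lip1 x y; have a3 := lip2 x y.
  rewrite normrZ (ger0_norm (e0 t)).
  have a4 : e t * `|gPsi (P x) - gPsi (P y)| <= eps t0 * (2 * L2 * `|x - y|) by rewrite ler_pM.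
  have b1 : 0 <= gamma * `|x - y| by rewrite mulr_ge0.
  have b2 : 0 <= (2 * L1 + eps t0 * (2 * L2)) * `|u - v| by rewrite mulr_ge0// addr_ge0// !mulr_ge0.
  by move: b1 b2 a1 a2 a4; move: (`|x - y|) (`|u - v|) => p q; lra.
- move=> x v xc vc t; apply: cvgN; apply: cvgD; first apply: cvgD.
  + by apply: cvgZl_tmp; exact: vc.
  + apply: (@continuous_comp _ _ _ x (gPhi \o P)); first exact: xc.
    exact: (lipschitz_continuous lip1).
  + apply: cvgZ; first exact: ec.
    apply: (@continuous_comp _ _ _ x (gPsi \o P)); first exact: xc.
    exact: (lipschitz_continuous lip2).
- move=> v0; exists (gamma * `|v0| + (`|gPhi 0| + L1 * A) + eps t0 * (`|gPsi 0| + L2 * A)).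
  move=> t x; rewrite normrN.
  have n0 : `|0 : H| <= A by rewrite normr0 ltW.
  have b1 : `|gPhi (P x)| <= `|gPhi 0| + L1 * A.
    rewrite -[gPhi (P x)](subrK (gPhi 0)) addrC (le_trans (ler_normD _ _))// lerD2l.
    by rewrite (le_trans (h1 _ _ _ _))// subr0 ler_wpM2l.
  have b2 : `|gPsi (P x)| <= `|gPsi 0| + L2 * A.
    rewrite -[gPsi (P x)](subrK (gPsi 0)) addrC (le_trans (ler_normD _ _))// lerD2l.
    by rewrite (le_trans (h2 _ _ _ _))// subr0 ler_wpM2l.
  rewrite (le_trans (ler_normD _ _))// lerD//.
    by rewrite (le_trans (ler_normD _ _))// lerD// normrZ ger0_norm.
  by rewrite normrZ (ger0_norm (e0 t)) ler_pM.
- by move=> t x u tt0 xA; rewrite /P radial_retraction_id// /e max_l.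
Qed.

End TruncatedField.

Lemma nonincreasing_is_derive_le0 {R : realType} (f : R -> R) (a t df : R) :
  (forall s u, a <= s -> s <= u -> f u <= f s) -> a < t -> is_derive t 1 f df -> df <= 0.
Proof.
move=> fni at_ /is_derive_diff_quotient h.
have ha : \forall s \near t^', a < s by apply: cvg_within (lt_nbhsr at_).
apply: (cvgr_to_le h); near=> s.
have sa : a <= s by apply: ltW; near: s.
rewrite /diff_quotient /GRing.scale/=; have [st|ts] := leP s t.
  by rewrite mulr_le0_ge0 ?invr_le0 ?subr_le0// subr_ge0 fni.
by rewrite mulr_ge0_le0 ?invr_ge0 ?subr_ge0 ?subr_le0 ?fni// ltW.
Unshelve. all: by end_near. Qed.

(** * Energy dissipation *)

Section Energy.
Context {R : realType} {H : completeNormedModType R}.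
Variable dot : {dot H for (@idfun R)}.
Hypothesis dot_norm : forall u : H, `|u| ^+ 2 = dot u u.
Variables (gamma : R) (Phi Psi : H -> R) (gPhi gPsi : H -> H) (eps : R -> R) (x v : R -> H).
Hypothesis Phi_chain : forall (y : R -> H) (t : R) dy, is_derive t 1 y dy ->
  is_derive t 1 (fun s => Phi (y s) : R^o) (dot (gPhi (y t)) dy).
Hypothesis Psi_chain : forall (y : R -> H) (t : R) dy, is_derive t 1 y dy ->
  is_derive t 1 (fun s => Psi (y s) : R^o) (dot (gPsi (y t)) dy).

(** Pairing the equation with [v t] cancels both gradient terms; friction and the drift of [eps]
    remain. Taking for [m] a lower bound of [Psi] makes the last term of the energy nonnegative when
    [eps] is. *)
Lemma is_derive_energy (t m deps : R) (w : H) :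
  is_derive t 1 x (v t) -> is_derive t 1 v w -> is_derive t 1 eps deps ->
  w + gamma *: v t + gPhi (x t) + eps t *: gPsi (x t) = 0 ->
  is_derive t 1 (fun s => 2^-1 * `|v s| ^+ 2 + Phi (x s) + eps s * (Psi (x s) - m))
    (- gamma * `|v t| ^+ 2 + deps * (Psi (x t) - m)).
Proof.
move=> xd vd ed eq.
have e0 : dot w (v t) + gamma * `|v t| ^+ 2 + dot (gPhi (x t)) (v t)
    + eps t * dot (gPsi (x t)) (v t) = 0.
  by rewrite dot_norm -!(dotZl dot) -!(dotDl dot) eq dot0l.
have h1 : is_derive t 1 (fun s => 2^-1 * `|v s| ^+ 2) (2^-1 * (dot w (v t) + dot w (v t))).
  have := is_deriveZ 2^-1 (is_derive_dot dot_norm vd vd); rewrite (dotC dot (v t) w).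
  by under eq_fun do rewrite -dot_norm.
have h2 := Phi_chain xd.
have h3 : is_derive t 1 (fun s => Psi (x s) - m) (dot (gPsi (x t)) (v t) - 0).
  by have := is_deriveB (Psi_chain xd) (is_derive_cst m t 1).
have h4 : is_derive t 1 (fun s => eps s * (Psi (x s) - m))
   (eps t * (dot (gPsi (x t)) (v t) - 0) + (Psi (x t) - m) * deps).
  by have := is_deriveM ed h3.
have -> : - gamma * `|v t| ^+ 2 + deps * (Psi (x t) - m) =
  2^-1 * (dot w (v t) + dot w (v t)) + dot (gPhi (x t)) (v t) +
  (eps t * (dot (gPsi (x t)) (v t) - 0) + (Psi (x t) - m) * deps) by lra.
by have := is_deriveD (is_deriveD h1 h2) h4.
Qed.

End Energy.

(** * Continuation of a solution past a finite time *)

Section Glue.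
Context {R : realType} {V : normedModType R}.
Implicit Types (f g h : R -> V) (t : R).

Lemma horizon_near (t tau tau' : R) : t < tau -> tau <= tau' ->
  \forall s \near t, horizon tau'%:E s <-> horizon tau%:E s.
Proof.
move=> ttau tt'; have := lt_nbhsl ttau; apply: filterS => s stau.
rewrite /horizon/= !lte_fin; split => -[s0 _]; split => //.
exact: lt_le_trans tt'.
Qed.

(** [h] agrees with both [f] and [g] on the overlap [t0, tau[, so near [tau] it is governed by [g]
    on both sides, while the one-sided derivative at 0 comes from [f]. Used for positions, then for
    velocities. *)
Lemma derive_in_glue f g h (dg : R -> V) (t0 tau tau' : R) :
  0 <= t0 -> t0 < tau -> tau <= tau' ->
  (forall t, horizon tau%:E t -> derivable_in (horizon tau%:E) f t) ->
  (forall t, t0 <= t -> is_derive t 1 g (dg t)) ->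
  (forall t, 0 <= t -> t < tau -> h t = f t) ->
  (forall t, t0 <= t -> t < tau' -> h t = g t) ->
  (forall t, 0 <= t -> t < tau -> derivable_in (horizon tau'%:E) h t /\
    derive_in (horizon tau'%:E) h t = derive_in (horizon tau%:E) f t) /\
  (forall t, tau <= t -> t < tau' -> derivable_in (horizon tau'%:E) h t /\
    derive_in (horizon tau'%:E) h t = dg t).
Proof.
move=> t00 t0tau tautau' fd gd hf hg; split=> t.
  move=> tge0 ttau; rewrite /derivable_in /derive_in.
  rewrite (derive_in_local (horizon_near ttau tautau') (g := f)) ?hf//.
    by split => //; apply: fd; split => //; rewrite lte_fin.
  by apply: filterE => s [s0]; rewrite lte_fin => stau; rewrite hf.
move=> taut ttau'.
have t0t : t0 < t by exact: lt_le_trans taut.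
apply/derive_in_interior; last first.
  apply: near_eq_is_derive (gd t (ltW t0t)).
  have := lt_nbhsl ttau'; have := lt_nbhsr t0t; apply: filterS2 => s s1 s2.
  by rewrite hg// ltW.
have := lt_nbhsl ttau'; have := lt_nbhsr t0t; apply: filterS2 => s s1 s2.
by rewrite /horizon/= lte_fin; split => //; apply: ltW; apply: le_lt_trans s1.
Qed.

End Glue.

Section GlobalExistence.
Context {R : realType} {H : completeNormedModType R}.
Variable dot : {dot H for (@idfun R)}.
Hypothesis dot_norm : forall u : H, `|u| ^+ 2 = dot u u.
Variables (gamma : R) (Phi Psi : H -> R) (eps : R -> R).
Hypothesis gamma_gt0 : 0 < gamma.
Hypotheses (Phi_diff : forall u : H, differentiable Phi u)
  (Psi_diff : forall u : H, differentiable Psi u).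
Hypotheses (Phi_lip : lipschitz_on_bounded (gradient dot Phi))
  (Psi_lip : lipschitz_on_bounded (gradient dot Psi)).
Hypotheses (Phi_ge0 : forall u, 0 <= Phi u) (Psi_lb : has_lbound (range Psi)).
Hypotheses (eps_gt0 : forall t, 0 <= t -> 0 < eps t)
    (eps_noninc : forall s t, 0 <= s -> s <= t -> eps t <= eps s)
    (eps_C1 : C1_on `[0, +oo[ eps).

Lemma eps_is_derive (t : R) : 0 < t -> is_derive t 1 eps (derive_in `[0, +oo[ eps t).
Proof.
move=> t0; apply/(@derive_in_interior R R^o `[0, +oo[).
  by have := lt_nbhsr t0; apply: filterS => s /ltW; rewrite /= in_itv/= andbT.
by split => //; apply: eps_C1.1; rewrite /= in_itv/= andbT ltW.
Qed.

Lemma solution_is_derive T x (t : R) : classical_solution dot gamma Phi Psi eps T x ->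
  let I := horizon T in 0 < t -> (t%:E < T)%E ->
  is_derive t 1 x (derive_in I x t) /\
  is_derive t 1 (derive_in I x) (derive_in I (derive_in I x) t).
Proof.
move=> [T0 [xd [vd _]] _] I t0 tT.
have It : I t by split => //; exact: ltW.
have In : \forall s \near t, I s.
  case: T tT @I It {T0 xd vd} => [r||]//=; rewrite ?lte_fin => tr It.
    have := lt_nbhsl tr; have := lt_nbhsr t0; apply: filterS2 => s s0 sr.
    by split; rewrite ?lte_fin// ltW.
  by have := lt_nbhsr t0; apply: filterS => s s0; split; rewrite ?ltry// ltW.
by split; apply/(derive_in_interior _ _ In); split => //; [exact: xd|exact: vd].
Qed.

Lemma solution_energy_le T x : classical_solution dot gamma Phi Psi eps T x ->
  let v := derive_in (horizon T) x in
  let E m t := 2^-1 * `|v t| ^+ 2 + Phi (x t) + eps t * (Psi (x t) - m) in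
  forall m s t, (forall u, m <= Psi u) -> 0 < s -> s <= t -> (t%:E < T)%E -> E m t <= E m s.
Proof.
move=> xs v E m s t mPsi s0 st tT.
pose deps := derive_in `[0, +oo[ eps.
apply: (@is_derive_le0 R (E m) (fun u => - gamma * `|v u| ^+ 2 + deps u * (Psi (x u) - m)) s t st).
  move=> u /andP[su ut].
  have u0 : 0 < u by exact: lt_le_trans su.
  have uT : (u%:E < T)%E by apply: le_lt_trans tT; rewrite lee_fin.
  have [xd vd] := solution_is_derive xs u0 uT.
  have [_ _ eq] := xs; have {}eq := eq u (conj (ltW u0) uT).
  exact: (@is_derive_energy R H dot dot_norm gamma Phi Psi _ _ eps x v
    (fun y r dy => is_derive_comp_gradient dot_norm (Phi_diff (y r)))
    (fun y r dy => is_derive_comp_gradient dot_norm (Psi_diff (y r)))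
    u m (deps u) _ xd vd (eps_is_derive u0) eq).
move=> u /andP[su ut].
have u0 : 0 < u by exact: lt_le_trans su.
have d0 : deps u <= 0.
  exact: (nonincreasing_is_derive_le0 eps_noninc u0 (eps_is_derive u0)).
have h1 : deps u * (Psi (x u) - m) <= 0 by rewrite mulr_le0_ge0// subr_ge0.
have h2 : 0 <= gamma * `|v u| ^+ 2 by rewrite mulr_ge0// ?ltW// exprn_gt0.
by rewrite mulNr; lra.
Qed.

Lemma solution_bounded (tau : R) x : 0 < tau ->
  classical_solution dot gamma Phi Psi eps tau%:E x ->
  exists A, forall t, tau / 2 <= t -> t < tau -> `|x t| <= A.
Proof.
move=> tau0 xs; have [m mlb] := Psi_lb.
have mPsi u : m <= Psi u by apply: mlb; exists u.
set v := derive_in (horizon tau%:E) x.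
pose E t := 2^-1 * `|v t| ^+ 2 + Phi (x t) + eps t * (Psi (x t) - m).
set t0 := tau / 2.
have t00 : 0 < t0 by rewrite divr_gt0.
(* From [|v|^2 <= 2 E t0] and [2 |v| <= |v|^2 + 1], without square roots. *)
pose V := 2 * E t0 + 1.
have vV t : t0 <= t -> t < tau -> `|v t| <= V.
  move=> t0t ttau.
  have : E t <= E t0 by apply: (solution_energy_le xs); rewrite ?lte_fin.
  rewrite {1}/E => h.
  have h1 := Phi_ge0 (x t).
  have h2 : 0 <= eps t * (Psi (x t) - m).
    by rewrite mulr_ge0 ?subr_ge0// ltW// eps_gt0// (le_trans _ t0t)// ltW.
  by rewrite /V; have := sqr_ge0 (`|v t| - 1); nra.
exists (`|x t0| + V * tau) => t t0t ttau.
have V0 : 0 <= V by apply: le_trans (vV t0 _ _) => //; rewrite /t0; lra.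
rewrite -[x t](subrK (x t0)) addrC (le_trans (ler_normD _ _))// lerD2l.
have := @norm_increment_le _ _ dot dot_norm x v (fun s => V * s) (fun=> V) t0 t t0t.
move=> /(_ _ _ _)/le_trans; apply.
- move=> s /andP[t0s st]; apply: (solution_is_derive xs _ _).1.
    exact: lt_le_trans t0s.
  by rewrite lte_fin; exact: le_lt_trans ttau.
- move=> s _; have := is_deriveZ V (is_derive_id s 1).
  by rewrite /GRing.scale/= mulr1.
- by move=> s /andP[t0s st]; apply: vV => //; exact: le_lt_trans ttau.
- by rewrite -mulrBr ler_wpM2l//; lra.
Qed.

Lemma maximal_solution_global T x :
  maximal_solution dot gamma Phi Psi eps T x -> T = +oo%E.
Proof.
case: T => [tau|//|[[]]]; last by [].
move=> [xs xmax]; exfalso; have [tau0 [xd [vd wc]] xeq] := xs.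
rewrite lte_fin in tau0.
have [A0 hA0] := solution_bounded tau0 xs.
set I := horizon tau%:E in xd vd wc xeq.
set v := derive_in I x in xeq vd wc; set w := derive_in I v in xeq wc.
pose t0 := tau / 2; have t00 : 0 < t0 by rewrite divr_gt0.
have t0tau : t0 < tau by rewrite /t0; lra.
(* The margin 1 lets the truncated solution run slightly past [tau] before it can leave the ball. *)
pose A := A0 + 1.
have A00 : 0 <= A0 by rewrite (le_trans _ (hA0 t0 _ _))// /t0; lra.
have Agt0 : 0 < A by rewrite /A; lra.
have epsc t : t0 <= t -> {for t, continuous eps}.
  move=> t0t; apply: is_derive_continuous (eps_is_derive _); exact: lt_le_trans t0t.
have epsb t : t0 <= t -> 0 <= eps t <= eps t0.
  by move=> t0t; rewrite eps_noninc ?(ltW t00)// ltW// eps_gt0// (le_trans _ t0t)// ltW.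
have [F [K [K0 Flip Fcont Fbnd FE]]] := truncated_field (ltW gamma_gt0) Agt0 Phi_lip Psi_lip epsc epsb.
have [B hB] := Fbnd (v t0).
have [y [u [r [y0 u0 rc yd]]]] := @ode2_exists R H dot dot_norm F K K0 Flip Fcont t0 (x t0) (v t0) B hB.
have wE s : t0 <= s -> s < tau -> w s = F s (x s) (v s).
  move=> t0s stau; rewrite FE//; last by rewrite (le_trans (hA0 _ _ _))// /A; lra.
  apply/eqP; rewrite -addr_eq0 !addrA; apply/eqP/xeq; split => //.
  by rewrite (le_trans _ t0s)// ltW.
have xy t : t0 <= t -> t < tau -> x t = y t /\ v t = u t.
  move=> t0t ttau.
  apply: (@ode2_unique R H dot dot_norm F K K0 Flip x v w y u r t0 t t0t _ _ (esym y0) (esym u0)).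
    move=> s /andP[t0s st]; have stau := le_lt_trans st ttau.
    by have [] := solution_is_derive xs (lt_le_trans t00 t0s) (stau : (s%:E < tau%:E)%E); split => //; exact: wE.
  by move=> s /andP[t0s _]; exact: yd.
have wr t : t0 <= t -> t < tau -> w t = r t.
  by move=> t0t ttau; rewrite wE//; have [-> ->] := xy t t0t ttau; have [_ _ ->] := yd t t0t.
have [yd' _ _] := yd tau (ltW t0tau).
have half : 0 < 2^-1 :> R by [].
have /cvgrPdist_lt/(_ _ half)[d /= d0 hd] := is_derive_continuous yd'.
(* Past [tau], [y t] is within 1/2 of [y tau], itself within 1/2 of some [y s = x s] with
   [s < tau]. *)
have yA t : t0 <= t -> t < tau + d -> `|y t| <= A.
  move=> t0t ttaud; have [ttau|taut] := ltP t tau.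
    by have [<- _] := xy t t0t ttau; rewrite (le_trans (hA0 t t0t ttau))// /A; lra.
  pose s := Num.max t0 (tau - d / 2).
  have t0s : t0 <= s by rewrite le_max lexx.
  have stau : s < tau by rewrite gt_max t0tau/=; lra.
  have sd : tau - d / 2 <= s by rewrite le_max lexx orbT.
  have h1 : `|y tau - y s| < 2^-1 by apply: hd; rewrite /= ger0_norm; lra.
  have h2 : `|y tau - y t| < 2^-1 by apply: hd; rewrite /= ler0_norm; lra.
  have h3 : `|y s| <= A0 by have [<- _] := xy s t0s stau; exact: hA0.
  have := ler_normB (y s + (y tau - y s)) (y tau - y t).
  have := ler_normD (y s) (y tau - y s).
  have -> : y s + (y tau - y s) - (y tau - y t) = y t by rewrite (addrC (y s)) subrK opprB addrC subrK.
  by rewrite /A; lra.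
pose tau' := tau + d; pose J := horizon tau'%:E.
have tautau' : tau <= tau' by rewrite /tau'; lra.
pose z t := if t < tau then x t else y t.
have [|||zd1 zd2] := @derive_in_glue R H x y z u t0 tau tau' (ltW t00) t0tau tautau' xd.
  - by move=> t /yd[].
  - by move=> t _ ttau; rewrite /z ttau.
  - by move=> t t0t _; rewrite /z; case: ifPn => // ttau; have [] := xy t t0t ttau.
have [|||zdd1 zdd2] := @derive_in_glue R H v u (derive_in J z) r t0 tau tau' (ltW t00) t0tau tautau' vd.
  - by move=> t /yd[].
  - by move=> t t_ge0 ttau; have [_] := zd1 t t_ge0 ttau.
  - move=> t t0t ttau'; have [ttau|taut] := ltP t tau; last by have [] := zd2 t taut ttau'.
    have [_ ->] := zd1 t (le_trans (ltW t00) t0t) ttau.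
    by have [] := xy t t0t ttau.
rewrite -/J in zd1 zd2 zdd1 zdd2.
have Jcase t : J t -> (0 <= t /\ t < tau) \/ (tau <= t /\ t < tau').
  by rewrite /J /horizon/= lte_fin => -[t_ge0 ttau']; case: (ltP t tau); [left|right].
apply: (xmax tau'%:E z).
- by rewrite lte_fin /tau'; lra.
- rewrite -/J; split; first by rewrite lte_fin /tau'; lra.
    split; first by move=> t /Jcase[[a b]|[a b]]; [case: (zd1 t a b)|case: (zd2 t a b)].
    split; first by move=> t /Jcase[[a b]|[a b]]; [case: (zdd1 t a b)|case: (zdd2 t a b)].
    apply/subspace_continuousP => t /Jcase[[a b]|[a b]]; apply/cvgrPdist_le => e e0;
      rewrite /from_subspace -/J.
      have It : I t by split => //; rewrite lte_fin.
      have /cvgrPdist_le/(_ _ e0) := (subspace_continuousP _ _).1 wc t It; rewrite /from_subspace.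
      have [_ ->] := zdd1 t a b; have := lt_nbhsl b; rewrite !near_withinE.
      apply: filterS2 => s stau ws Js.
      have [s0 _] := Js; have [_ ->] := zdd1 s s0 stau.
      by apply: ws; split => //; rewrite lte_fin.
    have [_ ->] := zdd2 t a b.
    have /cvgrPdist_le/(_ _ e0) := rc t.
    have := lt_nbhsl b; have := lt_nbhsr (lt_le_trans t0tau a); rewrite near_withinE.
    apply: filterS3 => s t0s stau' rs _; have [stau|taus] := ltP s tau.
      have [_ ->] := zdd1 s (ltW (lt_trans t00 t0s)) stau.
      by rewrite -/I -/v -/w (wr _ (ltW t0s) stau).
    by have [_ ->] := zdd2 s taus stau'.
  move=> t /Jcase[[a b]|[a b]].
    have [_ ->] := zdd1 t a b; have [_ ->] := zd1 t a b; rewrite /z b; apply: xeq.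
    by split => //; rewrite lte_fin.
  have [_ ->] := zdd2 t a b; have [_ ->] := zd2 t a b; rewrite /z ltNge a/=.
  have t0t : t0 <= t by exact: le_trans (ltW t0tau) a.
  have [_ _ ->] := yd t t0t; rewrite FE ?yA//.
  by apply/eqP; rewrite -!addrA addrC addr_eq0 opprK !addrA.
- by move=> t [a]; rewrite lte_fin => b; rewrite /z b.
Qed.

End GlobalExistence.

(** * Asymptotic analysis *)

Section RealAsymptotics.
Context {R : realType}.
Implicit Types f df : R -> R.

Lemma is_derive_unbounded_below f df (a m c : R) : 0 < c ->
  (forall t, a <= t -> is_derive t 1 f (df t)) -> (forall t, a <= t -> df t <= - c) ->
  (forall t, a <= t -> m <= f t) -> False.
Proof.
move=> c0 fd dfc mf.
pose t := a + `|f a - m| / c + 1.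
have at_ : a <= t.
  by rewrite /t -addrA lerDl addr_ge0// divr_ge0// ltW.
have [s /andP[as_ _] h] := @is_derive_mvt R f df a t at_ (fun s h => fd s (proj1 (andP h))).
have := dfc s as_; have := mf t at_; have := ler_norm (f a - m).
have ta : t - a = `|f a - m| / c + 1 by rewrite /t; lra.
have tc : c * (t - a) = `|f a - m| + c by rewrite ta; field; rewrite gt_eqF.
have ta0 : 0 <= t - a by rewrite subr_ge0.
move=> h1 h2 h3; have : df s * (t - a) <= - c * (t - a) by rewrite ler_wpM2r.
by rewrite mulNr tc -h; lra.
Qed.

(** Multiplied by the integrating factor [expR (g * (s - a))], [f - C / g] is nonincreasing. *)
Lemma linear_ode_bound f df (g C a t : R) : 0 < g -> a <= t ->
  (forall s, a <= s -> is_derive s 1 f (df s)) ->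
  (forall s, a <= s -> df s + g * f s <= C) -> f t <= `|f a| + 2 * `|C / g|.
Proof.
move=> g0 at_ fd fC.
pose k s := (f s - C / g) * (1 * expR (g * (s - a))).
have kd s : a <= s <= t -> is_derive s 1 k
  ((f s - C / g) * (1 * g * expR (g * (s - a))) + (1 * expR (g * (s - a))) * (df s - 0)).
  move=> /andP[as_ _].
  have h1 : is_derive s 1 (fun s => f s - C / g) (df s - 0).
    by have := is_deriveB (fd s as_) (is_derive_cst (C / g) s 1).
  by have := is_deriveM h1 (is_derive_expR_affine 1 g a s).
have : k t <= k a.
  apply: (is_derive_le0 at_ kd) => s /andP[as_ _].
  rewrite subr0 !mul1r mulrA (mulrC (expR _)) -mulrDl pmulr_lle0 ?expR_gt0//.
  have := fC s as_; rewrite mulrBl divfK ?gt_eqF//; lra.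
rewrite /k subrr mulr0 expR0 !mulr1 mul1r => h.
have E1 : 1 <= expR (g * (t - a)) by rewrite -expR0 ler_expR mulr_ge0 ?subr_ge0// ltW.
have h1 := ler_norm (f a - C / g); have h2 := ler_normB (f a) (C / g).
have h3 := ler_norm (C / g); have h4 := normr_ge0 (f a - C / g).
have : f t - C / g <= `|f a - C / g|.
  have [d0|d0] := leP (f t - C / g) 0; first exact: le_trans h4.
  apply: (le_trans _ h1); apply: le_trans h; rewrite -[leLHS]mulr1 ler_wpM2l// ltW//.
lra.
Qed.

End RealAsymptotics.

Section Asymptotics.
Context {R : realType} {H : completeNormedModType R}.
Variable dot : {dot H for (@idfun R)}.
Hypothesis dot_norm : forall u : H, `|u| ^+ 2 = dot u u.
Variables (gamma : R) (Phi Psi : H -> R) (gPhi gPsi : H -> H).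
Variables (eps deps : R -> R) (x v w : R -> H) (m : R).
Hypothesis gamma_gt0 : 0 < gamma.
Hypothesis Phi_chain : forall (y : R -> H) (t : R) dy, is_derive t 1 y dy ->
  is_derive t 1 (fun s => Phi (y s) : R^o) (dot (gPhi (y t)) dy).
Hypothesis Psi_chain : forall (y : R -> H) (t : R) dy, is_derive t 1 y dy ->
  is_derive t 1 (fun s => Psi (y s) : R^o) (dot (gPsi (y t)) dy).
Hypothesis Phi_convex : forall u z, Phi u + dot (gPhi u) (z - u) <= Phi z.
Hypothesis Psi_convex : forall u z, Psi u + dot (gPsi u) (z - u) <= Psi z.
Hypothesis Phi_ge0 : forall u, 0 <= Phi u.
Hypothesis Psi_ge : forall u, m <= Psi u.
Hypothesis eps_gt0 : forall t, 0 < t -> 0 < eps t.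
Hypothesis eps_deriv : forall (t : R), 0 < t -> is_derive t 1 eps (deps t).
Hypothesis deps_le0 : forall t, 0 < t -> deps t <= 0.
Hypothesis eps_cvg0 : eps t @[t --> +oo] --> 0.
Hypothesis x_deriv : forall (t : R), 0 < t -> is_derive t 1 x (v t).
Hypothesis v_deriv : forall (t : R), 0 < t -> is_derive t 1 v (w t).
Hypothesis ode : forall t, 0 < t -> w t + gamma *: v t + gPhi (x t) + eps t *: gPsi (x t) = 0.

(* [q] is a continuous minorant of the integrand of (H2) at [2 p], where
   [p = - gPsi z], and [G] is a bounded primitive of [q]. *)
Variables (z : H) (q G : R -> R) (M : R).
Hypothesis Phi_z : Phi z = 0.
Hypothesis G_deriv : forall (t : R), 0 < t -> is_derive t 1 G (q t).
Hypothesis q_ge0 : forall t, 0 < t -> 0 <= q t.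
Hypothesis q_ge : forall t, 0 < t ->
  2 * eps t * dot (- gPsi z) (x t - z) - Phi (x t) <= q t.
Hypothesis G_bnd : forall t, 0 < t -> 0 <= G t <= M.

Let E t := 2^-1 * `|v t| ^+ 2 + Phi (x t) + eps t * (Psi (x t) - m).
Let dE t := - gamma * `|v t| ^+ 2 + deps t * (Psi (x t) - m).
Let h t := 2^-1 * `|x t - z| ^+ 2.
Let K t := dot (v t) (x t - z) + gamma * h t.
Let dK t := `|v t| ^+ 2 - dot (gPhi (x t)) (x t - z) - eps t * dot (gPsi (x t)) (x t - z).
(** [gamma^-1 * E] cancels the [|v|^2] of [dK], and [2^-1 * G] the contribution of [q]. *)
Let N t := K t + gamma^-1 * E t - 2^-1 * G t.
Let dN t := dK t + gamma^-1 * dE t - 2^-1 * q t.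

Let E_deriv (t : R) : 0 < t -> is_derive t 1 E (dE t).
Proof.
move=> t0; exact: (@is_derive_energy R H dot dot_norm gamma Phi Psi gPhi gPsi eps x v
  Phi_chain Psi_chain t m (deps t) (w t) (x_deriv t0) (v_deriv t0) (eps_deriv t0) (ode t0)).
Qed.

Let epsPsi_ge0 t : 0 < t -> 0 <= eps t * (Psi (x t) - m).
Proof. by move=> t0; rewrite mulr_ge0 ?subr_ge0// ltW// eps_gt0. Qed.

Let E_ge t : 0 < t -> 2^-1 * `|v t| ^+ 2 + Phi (x t) <= E t.
Proof. by move=> t0; rewrite lerDl epsPsi_ge0. Qed.

Let E_ge0 t : 0 < t -> 0 <= E t.
Proof.
by move=> t0; rewrite (le_trans _ (E_ge t0))// addr_ge0// mulr_ge0// exprn_ge0.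
Qed.

Let dE_le t : 0 < t -> dE t <= - gamma * `|v t| ^+ 2.
Proof.
by move=> t0; rewrite gerDl mulr_le0_ge0 ?subr_ge0// deps_le0.
Qed.

Let dE_le_inv t : 0 < t -> gamma^-1 * dE t <= - `|v t| ^+ 2.
Proof. by move=> t0; rewrite ler_pdivrMl// mulrN -mulNr dE_le. Qed.

Let h_deriv (t : R) : 0 < t -> is_derive t 1 h (dot (v t) (x t - z)).
Proof.
move=> t0.
have xz : is_derive t 1 (fun s => x s - z) (v t).
  by have := is_deriveB (x_deriv t0) (is_derive_cst z t 1); rewrite subr0.
have -> : dot (v t) (x t - z) = 2^-1 * (dot (v t) (x t - z) + dot (x t - z) (v t)).
  by rewrite (dotC dot (x t - z) (v t)); lra.
have := is_deriveZ 2^-1 (is_derive_dot dot_norm xz xz).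
by under eq_fun do rewrite -dot_norm.
Qed.

Let K_deriv (t : R) : 0 < t -> is_derive t 1 K (dK t).
Proof.
move=> t0.
have xz : is_derive t 1 (fun s => x s - z) (v t).
  by have := is_deriveB (x_deriv t0) (is_derive_cst z t 1); rewrite subr0.
have h1 := is_derive_dot dot_norm (v_deriv t0) xz.
have h2 : is_derive t 1 (fun s => gamma * h s) (gamma * dot (v t) (x t - z)).
  by have := is_deriveZ gamma (h_deriv t0).
have -> : dK t = dot (w t) (x t - z) + dot (v t) (v t) + gamma * dot (v t) (x t - z).
  have : dot (w t + gamma *: v t + gPhi (x t) + eps t *: gPsi (x t)) (x t - z) = 0.
    by rewrite ode// dot0l.
  by rewrite !(dotDl dot) !(dotZl dot) /dK dot_norm; lra.
by have := is_deriveD h1 h2.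
Qed.

Let dK_le t : dK t <= `|v t| ^+ 2 - Phi (x t) - eps t * dot (gPsi (x t)) (x t - z).
Proof.
have := Phi_convex (x t) z; rewrite Phi_z -opprB (dotNr dot) /dK; lra.
Qed.

Let dK_le2 t : 0 < t -> dK t <= `|v t| ^+ 2 - Phi (x t) - eps t * (Psi (x t) - Psi z).
Proof.
move=> t0; apply: (le_trans (dK_le t)); rewrite lerD2l lerN2 ler_wpM2l ?(ltW (eps_gt0 t0))//.
have := Psi_convex (x t) z; rewrite -(opprB (x t)) (dotNr dot); lra.
Qed.

Let N_deriv (t : R) : 0 < t -> is_derive t 1 N (dN t).
Proof.
move=> t0; have h1 := is_deriveZ gamma^-1 (E_deriv t0).
have h2 := is_deriveZ 2^-1 (G_deriv t0).
by have := is_deriveB (is_deriveD (K_deriv t0) h1) h2.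
Qed.

(** With [p = - gPsi z], [q_ge] bounds [eps t * dot p (x t - z)] by [(Phi (x t) + q t) / 2], which
    uses only half of the [- Phi (x t)] in [dK_le2]. *)
Let dN_le t : 0 < t -> dN t <= - (2^-1 * Phi (x t)).
Proof.
move=> t0; have := dK_le2 t0; have := dE_le_inv t0; have := q_ge t0.
have : eps t * - dot (- gPsi z) (x t - z) <= eps t * (Psi (x t) - Psi z).
  rewrite ler_wpM2l ?(ltW (eps_gt0 t0))// (dotNl dot) opprK.
  by have := Psi_convex z (x t); lra.
rewrite /dN; lra.
Qed.

Let noninc (f df : R -> R) (a : R) : 0 < a -> (forall t : R, 0 < t -> is_derive t 1 f (df t)) ->
  (forall t, a <= t -> df t <= 0) -> forall s t, a <= s -> s <= t -> f t <= f s.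
Proof.
move=> a0 fd df0 s t as_ st; apply: (is_derive_le0 st) => u /andP[su _].
  by apply: fd; rewrite (lt_le_trans a0)// (le_trans as_).
by apply: df0; exact: le_trans su.
Qed.

Let pos1 (t : R) : 1 <= t -> 0 < t. Proof. exact: lt_le_trans. Qed.

Let E_noninc (s t : R) : 1 <= s -> s <= t -> E t <= E s.
Proof.
apply: (noninc ltr01 E_deriv) => u /pos1 u0; apply: (le_trans (dE_le u0)).
by rewrite mulNr oppr_le0 mulr_ge0 ?exprn_ge0// ltW.
Qed.

Let N_noninc (s t : R) : 1 <= s -> s <= t -> N t <= N s.
Proof.
apply: (noninc ltr01 N_deriv) => u /pos1 u0; apply: (le_trans (dN_le u0)).
by rewrite oppr_le0 mulr_ge0.
Qed.

Let K_le (t : R) : 1 <= t -> K t <= N 1 + M.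
Proof.
move=> t1; have t0 := pos1 t1; have := N_noninc (lexx 1) t1.
have : 0 <= gamma^-1 * E t by rewrite mulr_ge0 ?E_ge0// invr_ge0 ltW.
by have /andP[] := G_bnd t0; rewrite {1}/N; lra.
Qed.

(** With 3/2 instead of the coefficient 1 of [N], half of [|v|^2] survives. The decay rate is then
    at least [E - eps (Psi z - m)], used for [E_cvg0]; the same quantity is [eps S], with [S] the
    rescaled energy below, used for [Psi_limsup]. *)
Let L t := K t + (3 / 2) * (gamma^-1 * E t).
Let dL t := dK t + (3 / 2) * (gamma^-1 * dE t).

Let L_deriv (t : R) : 0 < t -> is_derive t 1 L (dL t).
Proof.
move=> t0; have h1 := is_deriveZ (3 / 2) (is_deriveZ gamma^-1 (E_deriv t0)).
by have := is_deriveD (K_deriv t0) h1.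
Qed.

Let dL_le (t : R) : 0 < t ->
  dL t <= - (2^-1 * `|v t| ^+ 2 + Phi (x t) + eps t * (Psi (x t) - Psi z)).
Proof. by move=> t0; have := dE_le_inv t0; have := dK_le2 t0; rewrite /dL; lra. Qed.

(** The derivative of [h] is [dot (v t) (x t - z)], so [K_le] is the linear inequality
    [h' + gamma h <= N 1 + M]. *)
Let h_bounded : exists B, forall t, 1 <= t -> h t <= B.
Proof.
exists (`|h 1| + 2 * `|(N 1 + M) / gamma|) => t t1.
apply: (linear_ode_bound gamma_gt0 t1 (fun s s1 => h_deriv (pos1 s1))) => s.
exact: K_le.
Qed.

Let dot_v_le (t : R) : `|dot (v t) (x t - z)| <= `|v t| * `|x t - z|.
Proof. exact: cauchy_schwarz. Qed.

Let K_lb : exists C, forall t, 1 <= t -> C <= K t.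
Proof.
have [B hB] := h_bounded.
(* [|v| |x - z| <= |v|^2 / 2 + h], which is at most [E 1 + B]. *)
exists (- (E 1 + B)) => t t1.
have := hB t t1; have := E_ge (pos1 t1); have := E_noninc (lexx 1) t1; have := Phi_ge0 (x t).
have := dot_v_le t; rewrite ler_norml => /andP[h1 _].
have h2 : 0 <= gamma * h t by rewrite mulr_ge0 ?(ltW gamma_gt0)// mulr_ge0// exprn_ge0.
have := sqr_ge0 (`|v t| - `|x t - z|).
move: h2 h1; rewrite /K /h; move: (`|v t|) (`|x t - z|) (dot _ _) => a b c; nra.
Qed.

Let L_lb : exists C, forall t, 1 <= t -> C <= L t.
Proof.
have [C hC] := K_lb; exists C => t t1; rewrite (le_trans (hC t t1))// lerDl.
by rewrite mulr_ge0// mulr_ge0 ?invr_ge0 ?(ltW gamma_gt0) ?E_ge0// pos1.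
Qed.

(** If [E] had a limit [e > 0], then, as [eps (Psi z - m)] tends to 0, [L] would eventually decrease
    at rate at least [e / 2], against [L_lb]. *)
Let E_cvg0 : E t @[t --> +oo] --> 0.
Proof.
have [e Ee Ege] := nonincreasing_lb_cvg E_noninc (fun t t1 => E_ge0 (pos1 t1)).
have e0 : 0 <= e by apply: (cvgr_to_ge Ee); near=> t; exact/E_ge0/pos1.
suff e0' : ~ 0 < e.
  by have -> : 0 = e by apply/eqP; rewrite eq_le e0/= leNgt; apply/negP.
move=> egt0; have [C hC] := L_lb.
have c0 : 0 < `|Psi z - m| + 1 by rewrite ltr_wpDl.
have [a a1 ha] : exists2 a, 1 <= a & forall t, a <= t -> eps t * (Psi z - m) <= e / 2.
  have : \forall t \near +oo, eps t * (`|Psi z - m| + 1) <= e / 2.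
    near=> t; rewrite -ler_pdivlMr//; near: t.
    by apply: (cvgr_le _ eps_cvg0); rewrite !divr_gt0.
  move=> [a [_ ha]]; exists (Num.max 1 (a + 1)); first by rewrite le_max lexx.
  move=> t; rewrite ge_max => /andP[t1 at_].
  have := ha t; rewrite (lt_le_trans _ at_) ?ltrDl// => /(_ isT); apply: le_trans.
  rewrite ler_wpM2l// ?(ltW (eps_gt0 (pos1 t1)))//.
  by rewrite (le_trans (ler_norm _))// lerDl.
apply: (@is_derive_unbounded_below R L dL a C (e / 2)).
- by rewrite divr_gt0.
- by move=> t at_; apply/L_deriv/pos1; exact: le_trans at_.
- move=> t at_; have t1 := le_trans a1 at_; apply: (le_trans (dL_le (pos1 t1))).
  by have := ha t at_; have := Ege t t1; rewrite /E; lra.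
- by move=> t at_; apply: hC; exact: le_trans at_.
Unshelve. all: by end_near. Qed.

Lemma Phi_cvg0 : Phi (x t) @[t --> +oo] --> 0.
Proof.
apply: (squeeze_cvgr _ (cvg_cst 0) E_cvg0); near=> t.
rewrite Phi_ge0/=; have t0 : 0 < t by [].
by have := E_ge t0; have := sqr_ge0 (`|v t|); lra.
Unshelve. all: by end_near. Qed.

Let v_cvg0 : `|v t| @[t --> +oo] --> 0.
Proof.
apply/cvgrPdist_le => e e0.
have : \forall t \near +oo, E t <= 2^-1 * e ^+ 2.
  by apply: (cvgr_le _ E_cvg0); rewrite mulr_gt0// exprn_gt0.
move=> hE; near=> t; rewrite sub0r normrN normr_id.
rewrite -(@ler_pXn2r _ 2) ?nnegrE ?(ltW e0)//.
have t0 : 0 < t by [].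
have : E t <= 2^-1 * e ^+ 2 by near: t.
by have := E_ge t0; have := Phi_ge0 (x t); lra.
Unshelve. all: by end_near. Qed.

Let N_cvg : exists n, N t @[t --> +oo] --> (n : R).
Proof.
have [C hC] := K_lb.
have [|n Nn _] := @nonincreasing_lb_cvg R N 1 (C - 2^-1 * M) N_noninc; last by exists n.
move=> t t1; have := hC t t1; have /andP[_] := G_bnd (pos1 t1).
have : 0 <= gamma^-1 * E t by rewrite mulr_ge0 ?E_ge0 ?pos1// invr_ge0 ltW.
by rewrite /N; lra.
Qed.

Lemma distance_cvg : exists l, `|x t - z| ^+ 2 @[t --> +oo] --> (l : R).
Proof.
have [B hB] := h_bounded; have [n Nn] := N_cvg.
have [||g Gg _] := @nonincreasing_lb_cvg R (fun t => - G t) 1 (- M).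
- apply: (@noninc _ (fun t => - q t) _ ltr01) => t; first by move/G_deriv/is_deriveN.
  by move=> /pos1 t0; rewrite oppr_le0 q_ge0.
- by move=> t /pos1 /G_bnd /andP[_]; rewrite lerN2.
have d0 : dot (v t) (x t - z) @[t --> +oo] --> 0.
  apply/(@norm_cvg0P _ R^o)/(@squeeze_cvgr _ _ _ _ (fun=> 0) (fun t => `|v t| * (2 * B + 1))).
  - near=> t; rewrite normr_ge0/= (le_trans (dot_v_le t))// ler_wpM2l//.
    have t1 : 1 <= t by near: t; exact: nbhs_pinfty_ge.
    by have := hB t t1; rewrite /h; have := sqr_ge0 (`|x t - z| - 1); nra.
  - exact: cvg_cst.
  - by rewrite -(mul0r (2 * B + 1)); apply: cvgMl.
exists (2 / gamma * (n - gamma^-1 * 0 - 2^-1 * g - 0)).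
(* [N] is solved for [h]. The other terms converge: [G] is monotone and bounded, and
   [dot (v t) (x t - z)] tends to 0 since [x t - z] is bounded. *)
have -> : (fun t => `|x t - z| ^+ 2) = (fun t => 2 / gamma *
    (N t - gamma^-1 * E t - 2^-1 * - G t - dot (v t) (x t - z))).
  by apply/funext => t; rewrite /N /K /h; field; rewrite gt_eqF.
apply: cvgMr; apply: cvgB => //; apply: cvgB; last exact: cvgMr.
by apply: cvgB => //; exact: cvgMr.
Unshelve. all: by end_near. Qed.

Hypothesis eps_int : exists I : R -> R, (forall t : R, 0 < t -> is_derive t 1 I (eps t)) /\
  forall M, exists2 t, 0 < t & M < I t.
Hypothesis deps_ge : exists2 k, 0 <= k & \forall t \near +oo, - deps t <= k * eps t ^+ 2.

Let Q t := 2^-1 * `|v t| ^+ 2 + Phi (x t).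
(* Rescaled energy: its derivative is at most [k Q] by (H3), which is compensated
   by the decay of [2 k N + k / (2 gamma) E]. *)
Let S t := (eps t)^-1 * Q t + (Psi (x t) - Psi z).
Let dS t := - (gamma * `|v t| ^+ 2) / eps t - deps t * (eps t)^-2 * Q t.

Let S_deriv (t : R) : 0 < t -> is_derive t 1 S (dS t).
Proof.
move=> t0; have e0 := eps_gt0 t0.
have e1 : eps t != 0 by rewrite gt_eqF.
have h0 : dot (w t) (v t) + gamma * `|v t| ^+ 2 + dot (gPhi (x t)) (v t)
    + eps t * dot (gPsi (x t)) (v t) = 0.
  by rewrite dot_norm -!(dotZl dot) -!(dotDl dot) ode// dot0l.
have hQ : is_derive t 1 Q (2^-1 * (dot (w t) (v t) + dot (w t) (v t)) + dot (gPhi (x t)) (v t)).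
  have h1 : is_derive t 1 (fun s => 2^-1 * `|v s| ^+ 2) (2^-1 * (dot (w t) (v t) + dot (w t) (v t))).
    have := is_deriveZ 2^-1 (is_derive_dot dot_norm (v_deriv t0) (v_deriv t0)).
    rewrite (dotC dot (v t) (w t)).
    by under eq_fun do rewrite -dot_norm.
  by have := is_deriveD h1 (Phi_chain (x_deriv t0)).
have hV : is_derive t 1 (fun s => (eps s)^-1) (- (eps t) ^- 2 * deps t).
  exact: (is_deriveV e1 (eps_deriv t0)).
have hP : is_derive t 1 (fun s => Psi (x s) - Psi z) (dot (gPsi (x t)) (v t) - 0).
  by have := is_deriveB (Psi_chain (x_deriv t0)) (is_derive_cst (Psi z) t 1).
have := is_deriveD (is_deriveM hV hQ) hP.
set d := (X in is_derive _ _ _ X -> _).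
suff -> : d = dS t by [].
rewrite /d /dS /GRing.scale/= -/(Q t).
(* Divided by [eps t], the equation trades the drift of [Psi (x t)] for [- gamma |v|^2 / eps] and
   terms that cancel the derivative of [Q] over [eps]. *)
have -> : dot (gPsi (x t)) (v t) = - (dot (w t) (v t) + gamma * `|v t| ^+ 2 + dot (gPhi (x t)) (v t)) / eps t.
  by apply: (mulIf e1); rewrite divfK//; lra.
by field.
Qed.

Lemma Psi_limsup (e : R) : 0 < e -> \forall t \near +oo, Psi (x t) <= Psi z + e.
Proof.
move=> e_gt0; have [k k0 [a [_ ha]]] := deps_ge; have [C hC] := L_lb; have [C' hC'] := K_lb.
pose b := Num.max 1 (a + 1).
have b1 : 1 <= b by rewrite le_max lexx.
have b0 : 0 < b by exact: pos1.
have ba t : b <= t -> - deps t <= k * eps t ^+ 2.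
  by rewrite ge_max => /andP[_ at_]; apply: ha; rewrite (lt_le_trans _ at_)// ltrDl.
pose W t := S t + 2 * k * N t + (k / 2) * (gamma^-1 * E t).
pose dW t := dS t + 2 * k * dN t + (k / 2) * (gamma^-1 * dE t).
have Wd (t : R) : 0 < t -> is_derive t 1 W (dW t).
  move=> t0; have h1 := is_deriveZ (2 * k) (N_deriv t0).
  have h2 := is_deriveZ (k / 2) (is_deriveZ gamma^-1 (E_deriv t0)).
  by have := is_deriveD (is_deriveD (S_deriv t0) h1) h2.
have Q0 t : 0 <= Q t by rewrite addr_ge0// mulr_ge0// exprn_ge0.
have dW0 t : b <= t -> dW t <= 0.
  move=> bt; have t1 := le_trans b1 bt; have t0 := pos1 t1; have e0 := eps_gt0 t0.
  have h1 : - deps t * (eps t)^-2 * Q t <= k * Q t.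
    rewrite ler_wpM2r// ler_pdivrMr ?exprn_gt0//; exact: ba.
  have h2 : 0 <= gamma * `|v t| ^+ 2 / eps t.
    by rewrite divr_ge0 ?(ltW e0)// mulr_ge0 ?(ltW gamma_gt0)// exprn_ge0.
  have h3 : 2 * k * dN t <= 2 * k * - (2^-1 * Phi (x t)) by rewrite ler_wpM2l ?mulr_ge0// dN_le.
  have h4 : k / 2 * (gamma^-1 * dE t) <= k / 2 * - `|v t| ^+ 2.
    by rewrite ler_wpM2l ?divr_ge0// dE_le_inv.
  move: h1; rewrite /dW /dS /Q; move: h2 h3 h4.
  by rewrite !mulNr; move: (`|v t| ^+ 2) (dN t) (dE t) => *; lra.
have S_ge t : 0 < t -> Psi (x t) - Psi z <= S t.
  by move=> t0; rewrite lerDr mulr_ge0// invr_ge0 ltW// eps_gt0.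
have [|l Wl _] := @nonincreasing_lb_cvg R W b (m - Psi z + 2 * k * (C' - 2^-1 * M)) (noninc b0 Wd dW0).
  move=> t bt; have t1 := le_trans b1 bt; have t0 := pos1 t1.
  have := S_ge t t0; have := Psi_ge (x t).
  have h0 : 0 <= gamma^-1 * E t by rewrite mulr_ge0 ?E_ge0// invr_ge0 ltW.
  have : 0 <= k / 2 * (gamma^-1 * E t) by rewrite mulr_ge0// divr_ge0.
  have : 2 * k * (C' - 2^-1 * M) <= 2 * k * N t.
    rewrite ler_wpM2l ?mulr_ge0//.
    by have := hC' t t1; have /andP[_] := G_bnd t0; rewrite /N; lra.
  by rewrite /W; lra.
have [n Nn] := N_cvg; pose s := l - 2 * k * n - (k / 2) * (gamma^-1 * 0).
have Ss : S t @[t --> +oo] --> s.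
  have -> : S = (fun t => W t - 2 * k * N t - (k / 2) * (gamma^-1 * E t)).
    by apply/funext => t; rewrite /W; lra.
  by apply: cvgB; [apply: cvgB => //; exact: cvgMr|do 2 apply: cvgMr].
(* [S] dominates [Psi (x t) - Psi z], so a nonpositive limit concludes; a positive one is refuted
   with (H1). *)
have [s0|s0] := leP s 0.
  have hS : \forall t \near +oo, S t <= e by apply: (cvgr_le _ Ss); exact: le_lt_trans e_gt0.
  near=> t.
  have t0 : 0 < t by [].
  have : S t <= e by near: t.
  by have := S_ge t t0; lra.
exfalso.
have : \forall t \near +oo, s / 2 <= S t by apply: (cvgr_ge _ Ss); lra.
move=> [c [_ hc]]; pose d := Num.max b (c + 1).
have db : b <= d by rewrite le_max lexx.
have dc t : d <= t -> s / 2 <= S t.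
  by rewrite ge_max => /andP[_ ct]; apply: hc; rewrite (lt_le_trans _ ct)// ltrDl.
have d0 : 0 < d by exact: lt_le_trans db.
have [I [Id Iunb]] := eps_int.
(* Eventually [dL <= - eps S <= - (s / 2) eps], so [L + (s / 2) I] is nonincreasing, although [L] is
   bounded below and [I] is unbounded above. *)
have LId (t : R) : 0 < t -> is_derive t 1 (fun t => L t + s / 2 * I t) (dL t + s / 2 * eps t).
  by move=> t0; have := is_deriveD (L_deriv t0) (is_deriveZ (s / 2) (Id t t0)).
have LI0 t : d <= t -> dL t + s / 2 * eps t <= 0.
  move=> dt; have t0 := lt_le_trans d0 dt; have e0 := eps_gt0 t0.
  have h1 : eps t * (s / 2) <= eps t * S t by rewrite ler_wpM2l ?(ltW e0)// dc.
  have h2 : eps t * S t = Q t + eps t * (Psi (x t) - Psi z).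
    by rewrite /S mulrDr mulVKf// gt_eqF.
  by have := dL_le t0; rewrite -/(Q t); lra.
have [t t0 ht] := Iunb ((L d + s / 2 * I d - C) / (s / 2)).
pose u := Num.max t d.
have du : d <= u by rewrite le_max lexx orbT.
have Iu : I t <= I u.
  have tu : t <= u by rewrite le_max lexx.
  have [r /andP[tr _] hr] := @is_derive_mvt R I eps t u tu (fun r h => Id r (lt_le_trans t0 (proj1 (andP h)))).
  by rewrite -subr_ge0 hr mulr_ge0 ?subr_ge0// ltW// eps_gt0// (lt_le_trans t0).
have := @noninc _ _ _ d0 LId LI0 d u (lexx d) du.
have := hC u (le_trans b1 (le_trans db du)).
move: ht; rewrite ltr_pdivrMr ?divr_gt0//.
have : I t * (s / 2) <= I u * (s / 2) by rewrite ler_wpM2r// divr_ge0// ltW.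
lra.
Unshelve. all: by end_near. Qed.

End Asymptotics.

(* [ge0_le_integral] without its measurability assumptions. *)
Lemma ge0_integral_le_nomeas d (T : measurableType d) {R : realType}
    (mu : {measure set T -> \bar R}) (D : set T) (f g : T -> \bar R) :
  (forall t, D t -> (0 <= f t)%E) -> (forall t, D t -> (f t <= g t)%E) ->
  (\int[mu]_(t in D) f t <= \int[mu]_(t in D) g t)%E.
Proof.
move=> f0 fg.
have g0 t : D t -> (0 <= g t)%E by move=> Dt; apply: le_trans (fg t Dt); exact: f0.
rewrite !ge0_integralE//; apply: le_ereal_sup => _ [h hf <-]; exists h => // t.
apply: (le_trans (hf t)); rewrite /patch; case: ifPn => //.
by rewrite inE; exact: fg.
Qed.

(** * Weak convergence *)

Section UltrafilterLimits.
Context {R : realType} {H : completeNormedModType R}.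
Variable dot : {dot H for (@idfun R)}.
Hypothesis dot_norm : forall u : H, `|u| ^+ 2 = dot u u.

Lemma ultra_bounded_cvg (T : Type) (U : set_system T) (f : T -> R) (B : R) :
  UltraFilter U -> (\forall t \near U, `|f t| <= B) ->
  exists2 l : R, f t @[t --> U] --> l & `|l| <= B.
Proof.
move=> UU fB.
have cB := @segment_compact R (- B) B.
have [|l [lB cl]] := cB (f @ U) _.
  by move: fB; apply: filterS => t; rewrite /= in_itv/= -ler_norml.
exists l; last by rewrite ler_norml; move: lB; rewrite /= in_itv.
(* A cluster point of an ultrafilter is a limit: otherwise the complement of some neighbourhood
   would belong to the image filter, and the cluster point could not meet it. *)
move=> N Nl; have [//|h] := in_ultra_setVsetC (f @^-1` N) UU.
have [r [h1 h2]] := cl (~` N) N h Nl.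
by exfalso; exact: h1.
Qed.

(** Along an ultrafilter every bounded scalar [dot (x t) v] converges; the limits form a bounded
    linear form in [v], represented by Riesz. *)
Lemma ultra_weak_limit (T : Type) (U : set_system T) (x : T -> H) (B : R) :
  UltraFilter U -> (\forall t \near U, `|x t| <= B) ->
  exists l, forall v, dot (x t) v @[t --> U] --> dot l v.
Proof.
move=> UU xB.
have ex v : exists l : R, dot (x t) v @[t --> U] --> l /\ `|l| <= B * `|v|.
  have [|l xl lB] := @ultra_bounded_cvg T U (fun t => dot (x t) v) (B * `|v|) UU.
    by move: xB; apply: filterS => t tB; rewrite (le_trans (cauchy_schwarz dot_norm _ _))// ler_wpM2r.
  by exists l.
have [phi phiP] := choice ex.
have [|v|l hl] := @riesz R H dot dot_norm phi B.
- move=> k u v; apply: (@cvg_unique _ (@Rhausdorff R) (dot (x t) (k *: u + v) @[t --> U])).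
    exact: (phiP _).1.
  rewrite /=; under eq_fun do rewrite (dotDr dot) (dotZr dot).
  apply: cvgD; last exact: (phiP _).1.
  by apply: cvgMr; exact: (phiP _).1.
- exact: (phiP v).2.
by exists l => v; rewrite -hl; exact: (phiP v).1.
Qed.

Lemma opial (T : Type) (F : set_system T) (x : T -> H) (S : set H) :
  ProperFilter F -> S !=set0 ->
  (forall z, S z -> exists l : R, `|x t - z| ^+ 2 @[t --> F] --> l) ->
  (forall (U : set_system T) l, UltraFilter U -> F `<=` U ->
     (forall v, dot (x t) v @[t --> U] --> dot l v) -> S l) ->
  exists2 l, S l & forall v, dot (x t) v @[t --> F] --> dot l v.
Proof.
move=> FF [z0 Sz0] dist SU.
have [B xB] : exists B, \forall t \near F, `|x t| <= B.
  have [l hl] := dist z0 Sz0.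
  have l1 : l < l + 1 by rewrite ltrDl.
  have near_l : \forall t \near F, `|x t - z0| ^+ 2 <= l + 1 by exact: (cvgr_le _ hl).
  exists (`|z0| + (l + 2)); apply: filterS near_l => t ht.
  rewrite -[x t](subrK z0) addrC (le_trans (ler_normD _ _))// lerD2l.
  by have := sqr_ge0 (`|x t - z0| - 1); nra.
have lim U : UltraFilter U -> F `<=` U ->
    exists2 l, S l & forall v, dot (x t) v @[t --> U] --> dot l v.
  move=> UU FU; have [l hl] := ultra_weak_limit UU (FU _ xB).
  by exists l => //; exact: SU hl.
have [U0 [UU0 FU0]] := ultraFilterLemma FF.
have [l0 Sl0 hl0] := lim U0 UU0 FU0.
have uniq U l : UltraFilter U -> F `<=` U -> S l ->
    (forall v, dot (x t) v @[t --> U] --> dot l v) -> l = l0.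
  move=> UU FU Sl hl.
  have [c1 h1] := dist l Sl; have [c2 h2] := dist l0 Sl0.
  pose e := l - l0.
  (* This pairing is an affine function of two squared distances that converge along [F] itself, so
     its limits along [U] and [U0] coincide: [dot l e = dot l0 e]. *)
  have hF : dot (x t) e @[t --> F] --> 2^-1 * (c2 - c1 + (`|l| ^+ 2 - `|l0| ^+ 2)).
    have -> : (fun t => dot (x t) e) =
      (fun t => 2^-1 * (`|x t - l0| ^+ 2 - `|x t - l| ^+ 2 + (`|l| ^+ 2 - `|l0| ^+ 2))).
      apply/funext => t; rewrite /e !(normD2 dot_norm) !normrN (dotBr dot) !(dotNr dot); lra.
    by apply: cvgMr; apply: cvgD; [exact: cvgB|exact: cvg_cst].
  have d1 : dot l e = 2^-1 * (c2 - c1 + (`|l| ^+ 2 - `|l0| ^+ 2)).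
    apply: (@cvg_unique _ (@Rhausdorff R) (dot (x t) e @[t --> U])); first exact: hl.
    by apply: cvg_trans hF => A /= FA; exact: FU.
  have d2 : dot l0 e = 2^-1 * (c2 - c1 + (`|l| ^+ 2 - `|l0| ^+ 2)).
    apply: (@cvg_unique _ (@Rhausdorff R) (dot (x t) e @[t --> U0])); first exact: hl0.
    by apply: cvg_trans hF => A /= FA; exact: FU0.
  apply/eqP; rewrite -subr_eq0 -normr_eq0 -sqrf_eq0 dot_norm -/e.
  by rewrite {1}/e (dotBl dot) d1 d2 subrr.
exists l0 => // v; apply/cvgrPdist_le => e e0.
apply: contrapT => nF.
(* If convergence failed, some ultrafilter finer than [F] would contain the bad set [A], yet its
   weak limit would again be [l0]. *)
pose A := [set t | ~ `|dot l0 v - dot (x t) v| <= e].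
have WF : ProperFilter (within A F).
  apply: Build_ProperFilter => h; apply: nF; move: h; rewrite /within/=.
  by apply: filterS => t h; apply: contrapT => /h.
have [U [UU WU]] := ultraFilterLemma WF.
have FU : F `<=` U.
  by move=> D FD; apply: WU; rewrite /within/=; move: FD; apply: filterS.
have [l Sl hl] := lim U UU FU.
have ll0 := uniq U l UU FU Sl hl; rewrite ll0 in hl.
have UA : U A by apply: WU; rewrite /within/=; exact: filterE.
have /cvgrPdist_le/(_ _ e0) hU := hl v.
by have [t [At]] := filter_ex (filterI UA hU).
Qed.

(** The affine minorant of [f] at [l] is weakly continuous, so the eventual upper bounds pass to the
    limit through it. *)
Lemma weak_lsc (T : Type) (F : set_system T) (x : T -> H) (l g : H) (f : H -> R) (c : R) :
  ProperFilter F -> (forall u, f l + dot g (u - l) <= f u) ->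
  (forall v, dot (x t) v @[t --> F] --> dot l v) ->
  (forall e, 0 < e -> \forall t \near F, f (x t) <= c + e) -> f l <= c.
Proof.
move=> FF fg xl fc; apply/ler_addgt0Pr => e e0.
have h : f l + (dot (x t) g - dot l g) @[t --> F] --> f l + (dot l g - dot l g).
  by apply: cvgD; [exact: cvg_cst|apply: cvgB; [exact: xl|exact: cvg_cst]].
rewrite subrr addr0 in h; apply: (cvgr_to_le h).
apply: filterS (fc e e0) => t; apply: le_trans.
by rewrite -(dotBl dot) (dotC dot); exact: fg.
Qed.

End UltrafilterLimits.

(** Relative derivability gives only relative continuity at 0; freezing [f] before 0 turns it into
    the continuity on all of [R] that [ge0_antiderivative] requires. *)
Lemma continuous_clamp {R : realType} {V : normedModType R} (f : R -> V) (I : set R) :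
  (forall t, 0 <= t -> I t) -> (forall t, 0 <= t -> derivable_in I f t) ->
  continuous (fun t : R => f (Num.max t 0)).
Proof.
move=> I0 fd t.
have mt : 0 <= Num.max t 0 by rewrite le_max lexx orbT.
apply: (@cvg_comp _ _ _ (fun t => Num.max t 0) f _ (within I (nbhs (Num.max t 0)))).
  move=> A /=; rewrite /within/= => hA.
  have mc : (fun t : R => Num.max t 0) s @[s --> t] --> Num.max t 0.
    exact: (continuous_max cvg_id (cvg_cst _)).
  have : \forall s \near t, I (Num.max s 0) -> A (Num.max s 0) := mc _ hA.
  by apply: filterS => s; apply; apply: I0; rewrite le_max lexx orbT.
by apply: derivable_in_continuous; [exact: I0|exact: fd].
Qed.

Section FenchelBound.
Context {R : realType} {H : completeNormedModType R}.
Variable dot : {dot H for (@idfun R)}.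

(** Normality of [p] at [z] means that the support function is attained there, hence finite, so the
    difference makes sense even when the conjugate is infinite. *)
Lemma fenchel_gap_ge (Phi : H -> R) (C : set H) (p z u : H) :
  C z -> (forall y, C y -> dot p (y - z) <= 0) ->
  ((dot p (u - z) - Phi u)%:E <=
    fenchel_conjugate dot Phi p - support_function dot C p)%E.
Proof.
move=> Cz pz.
have -> : support_function dot C p = (dot p z)%:E.
  apply/eqP; rewrite eq_le; apply/andP; split.
    apply: ge_ereal_sup => _ [y Cy <-]; rewrite lee_fin -subr_le0 -(dotBr dot).
    exact: pz.
  by apply: ereal_sup_ubound; exists z.
have : ((dot p u - Phi u)%:E <= fenchel_conjugate dot Phi p)%E.
  by apply: ereal_sup_ubound; exists u.
rewrite (dotBr dot); move: (fenchel_conjugate _ _ _) => [r| |]//=.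
  by rewrite -EFinB !lee_fin; lra.
by move=> _; rewrite addye// leey.
Qed.

End FenchelBound.

(** * From (H1), (H2) and (H3) to the asymptotic estimates, and conclusion *)

Theorem theorem2p1 (R : realType) (H : completeNormedModType R)
    (dot : {dot H for (@idfun R)})
    (dot_norm : forall u : H, `|u| ^+ 2 = dot u u)
    (gamma : R) (gamma_gt0 : 0 < gamma)
    (Phi Psi : H -> R) (C S : set H) (eps : R -> R)
    (* (a) *)
    (Phi_convex : convex_function [set: H] Phi)
    (Phi_diff : forall u : H, differentiable Phi u)
    (Phi_lip : lipschitz_on_bounded (gradient dot Phi))
    (C_argmin : C = argmin_on [set: H] Phi)
    (C_zero : C = Phi @^-1` [set 0])
    (C_neq0 : C !=set0)
    (* (b) *)
    (Psi_convex : convex_function [set: H] Psi)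
    (Psi_diff : forall u : H, differentiable Psi u)
    (Psi_lip : lipschitz_on_bounded (gradient dot Psi))
    (Psi_lb : has_lbound (range Psi))
    (* (c) *)
    (S_argmin : S = argmin_on C Psi)
    (S_neq0 : S !=set0)
    (* (d) *)
    (eps_gt0 : forall t, 0 <= t -> 0 < eps t)
    (eps_noninc : forall s t, 0 <= s -> s <= t -> eps t <= eps s)
    (eps_C1 : C1_on `[0, +oo[ eps)
    (eps_cvg0 : eps t @[t --> +oo] --> 0)
    (deps_cvg0 : derive_in `[0, +oo[ eps t @[t --> +oo] --> 0)
    (T : \bar R) (x : R -> H)
    (x_max : maximal_solution dot gamma Phi Psi eps T x) :
  T = +oo%E /\
  ((* (H1) *)
   (\int[lebesgue_measure]_(t in `[0%R, +oo[) (eps t)%:E = +oo)%E ->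
   (* (H2) *)
   (forall p : H, critical_cone dot C Psi p ->
     \int[lebesgue_measure]_(t in `[0%R, +oo[)
       (fenchel_conjugate dot Phi (eps t *: p)
        - support_function dot C (eps t *: p)) < +oo)%E ->
   (* (H3) *)
   (exists2 k : R, 0 < k &
     \forall t \near +oo,
       0 <= - derive_in `[0, +oo[ eps t <= k * eps t ^+ 2) ->
   (exists2 xinf : H, S xinf & weakly_cvg (pinfty_nbhs R) x xinf) /\
   (Phi (x t) @[t --> +oo] --> 0 /\
    Psi (x t) @[t --> +oo] --> inf [set Psi z | z in C])).
Proof.
have Phi_ge0 u : 0 <= Phi u.
  have [z Cz] := C_neq0; have := Cz; rewrite C_argmin => -[_ /(_ u Logic.I)].
  by move: Cz; rewrite C_zero => /= ->.
have T_oo := maximal_solution_global dot_norm gamma_gt0 Phi_diff Psi_diff Phi_lip Psi_lip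
  Phi_ge0 Psi_lb eps_gt0 eps_noninc eps_C1 x_max.
split => // H1 H2 [k k_gt0 H3].
have [m mlb] := Psi_lb.
have mPsi u : m <= Psi u by apply: mlb; exists u.
have [xs _] := x_max; rewrite T_oo in xs.
pose I := horizon (+oo%E : \bar R).
have I0 t : 0 <= t -> I t by move=> t0; split => //; exact: ltry.
pose v := derive_in I x; pose w := derive_in I v.
have xd (t : R) : 0 < t -> is_derive t 1 x (v t).
  by move=> t0; have [] := solution_is_derive xs t0 (ltry t).
have vd (t : R) : 0 < t -> is_derive t 1 v (w t).
  by move=> t0; have [] := solution_is_derive xs t0 (ltry t).
have [_ [xdI _] x_ode] := xs.
have Psi_normal z : S z -> normal_cone dot C z (- gradient dot Psi z).
  rewrite S_argmin => Sz y Cy; rewrite (dotNl dot) oppr_le0.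
  apply: (argmin_on_gradient dot_norm _ (Psi_diff z) Sz) => s s01.
  have Phi0 u : C u -> Phi u = 0 by rewrite C_zero.
  (* [C] is the zero set of a nonnegative convex function, so it contains the segment. *)
  have := convex_function_segment z y Phi_convex s01.
  rewrite (Phi0 z Sz.1) (Phi0 y Cy) subrr mulr0 addr0 => Phis.
  by rewrite C_zero /=; apply/eqP; rewrite eq_le Phis Phi_ge0.
have Psi_cone z : S z -> critical_cone dot C Psi (2 *: - gradient dot Psi z).
  move=> Sz; exists 2, (- gradient dot Psi z); split => //.
  exists z; split => //; first by move: Sz; rewrite S_argmin => -[].
  by exists (- gradient dot Psi z); [exact: Psi_normal|rewrite subrr].
have [gPhi gPhiE] := ex_intro (fun g => g = gradient dot Phi) _ erefl.
have [gPsi gPsiE] := ex_intro (fun g => g = gradient dot Psi) _ erefl.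
rewrite -gPsiE in Psi_normal Psi_cone.
have Phi_chain (y : R -> H) (t : R) dy : is_derive t 1 y dy ->
    is_derive t 1 (fun s => Phi (y s) : R^o) (dot (gPhi (y t)) dy).
  by rewrite gPhiE; exact: is_derive_comp_gradient.
have Psi_chain (y : R -> H) (t : R) dy : is_derive t 1 y dy ->
    is_derive t 1 (fun s => Psi (y s) : R^o) (dot (gPsi (y t)) dy).
  by rewrite gPsiE; exact: is_derive_comp_gradient.
have Phi_cvx u z : Phi u + dot (gPhi u) (z - u) <= Phi z.
  by rewrite gPhiE; exact: convex_gradient_le.
have Psi_cvx u z : Psi u + dot (gPsi u) (z - u) <= Psi z.
  by rewrite gPsiE; exact: convex_gradient_le.
have ode (t : R) : 0 < t -> w t + gamma *: v t + gPhi (x t) + eps t *: gPsi (x t) = 0.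
  by move=> t0; rewrite gPhiE gPsiE; apply/x_ode/I0/ltW.
have clampE (t : R) : 0 <= t -> Num.max t 0 = t by exact: max_l.
have xc : continuous (fun t : R => x (Num.max t 0)).
  by apply: (continuous_clamp I0) => t t0; exact/xdI/I0.
have epsc : continuous (fun t : R => eps (Num.max t 0)).
  apply: (@continuous_clamp R R^o eps `[0, +oo[) => t t0; first by rewrite /= in_itv/= t0.
  by apply: eps_C1.1; rewrite /= in_itv/= t0.
have Phi0 z : S z -> Phi z = 0.
  by rewrite S_argmin => -[]; rewrite C_zero.
have qG z : S z -> exists (q G : R -> R) (M : R), [/\ forall t : R, 0 < t -> is_derive t 1 G (q t),
    forall t, 0 < t -> 0 <= q t,
    forall t, 0 < t -> 2 * eps t * dot (- gPsi z) (x t - z) - Phi (x t) <= q t &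
    forall t, 0 < t -> 0 <= G t <= M].
  move=> Sz; set p := - gPsi z.
  pose r (t : R) := 2 * eps (Num.max t 0) * dot p (x (Num.max t 0) - z) - Phi (x (Num.max t 0)).
  (* The positive part still lies below the integrand of (H2) at [2 *: p]: [g1] below handles [r],
     and [g2], the Fenchel gap taken at [z], handles 0. *)
  pose q (t : R) := Num.max 0 (r t).
  have Phic : continuous (fun t : R => Phi (x (Num.max t 0)) : R^o).
    move=> t; apply: (@continuous_comp R H R^o (fun t : R => x (Num.max t 0)) Phi t (xc t)).
    exact: differentiable_continuous.
  have dotc : continuous (fun t : R => dot p (x (Num.max t 0) - z) : R^o).
    move=> t; apply: cvg_dot => //; first exact: cvg_cst.
    by apply: cvgB; [exact: xc|exact: cvg_cst].
  have rc : continuous r.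
    by move=> t; exact: (cvgB (cvgM (cvgMr (epsc t)) (dotc t)) (Phic t)).
  have qc : continuous q by move=> t; exact: (continuous_max (cvg_cst _) (rc t)).
  have q0 t : 0 <= q t by rewrite le_max lexx.
  have [G [Gd G0 Gq _]] := ge0_antiderivative qc q0.
  have qlt : (\int[lebesgue_measure]_(t in `[0%R, +oo[) (q t)%:E < +oo)%E.
    apply: le_lt_trans (H2 _ (Psi_cone z Sz)); apply: ge0_integral_le_nomeas => t.
      by rewrite lee_fin.
    rewrite /= in_itv/= andbT => t0.
    have Cz : C z by move: Sz; rewrite S_argmin => -[].
    have e0 : 0 <= eps t * 2 by rewrite mulr_ge0// ltW// eps_gt0.
    have pz y : C y -> dot (eps t *: (2 *: p)) (y - z) <= 0.
      by move=> Cy; rewrite scalerA (dotZl dot) mulr_ge0_le0//; exact: Psi_normal.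
    have g1 := fenchel_gap_ge Phi (x t) Cz pz; have g2 := fenchel_gap_ge Phi z Cz pz.
    rewrite subrr (dot0r dot) Phi0// subrr in g2.
    rewrite /q /r clampE//; case: (leP 0) => [_|_]; last exact: g2.
    suff -> : 2 * eps t * dot p (x t - z) = dot (eps t *: (2 *: p)) (x t - z) by exact: g1.
    by rewrite scalerA (dotZl dot) (mulrC (eps t)).
  exists q, G, (fine (\int[lebesgue_measure]_(t in `[0%R, +oo[) (q t)%:E)%E); split => //.
    by move=> t t0; rewrite /q /r clampE ?(ltW t0)// le_max lexx orbT.
  move=> t t0; rewrite G0/=; have := Gq t; rewrite -[X in (_ <= X)%E]fineK ?lee_fin//.
  by rewrite ge0_fin_numE// integral_ge0// => s _; rewrite lee_fin.
have eps_int : exists I : R -> R, (forall t : R, 0 < t -> is_derive t 1 I (eps t)) /\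
    forall M, exists2 t, 0 < t & M < I t.
  have [|J [Jd _ _ JM]] := ge0_antiderivative epsc _; first by move=> t; rewrite ltW// eps_gt0// le_max lexx orbT.
  exists J; split; first by move=> t t0; have := Jd t t0; rewrite clampE// ltW.
  move=> M; apply: contrapT => hM.
  have /JM : forall t, 0 < t -> J t <= M.
    by move=> t t0; rewrite leNgt; apply/negP => Mt; apply: hM; exists t.
  suff -> : (\int[lebesgue_measure]_(t in `[0%R, +oo[) (eps (Num.max t 0))%:E = +oo)%E by [].
  rewrite -H1; apply: eq_integral => t; rewrite inE/= in_itv/= andbT => t0.
  by rewrite clampE.
pose deps := derive_in `[0, +oo[ eps.
have epsd (t : R) : 0 < t -> is_derive t 1 eps (deps t) by exact: eps_is_derive.
have deps0 t : 0 < t -> deps t <= 0.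
  by move=> t0; exact: (nonincreasing_is_derive_le0 eps_noninc t0 (epsd t t0)).
have eps_gt0' t : 0 < t -> 0 < eps t by move=> /ltW/eps_gt0.
have deps_ge : exists2 k, 0 <= k & \forall t \near +oo, - deps t <= k * eps t ^+ 2.
  by exists k; [exact: ltW|apply: filterS H3 => t /andP[]].
have dist z : S z -> exists l : R, `|x t - z| ^+ 2 @[t --> +oo] --> l.
  move=> Sz; have [q [G [M [Gd q0 qge GM]]]] := qG z Sz.
  exact: (distance_cvg dot_norm gamma_gt0 Phi_chain Psi_chain Phi_cvx Psi_cvx Phi_ge0 mPsi
    eps_gt0' epsd deps0 eps_cvg0 xd vd ode (Phi0 z Sz) Gd q0 qge GM).
have Psi_sup z e : S z -> 0 < e -> \forall t \near +oo, Psi (x t) <= Psi z + e.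
  move=> Sz; have [q [G [M [Gd q0 qge GM]]]] := qG z Sz.
  exact: (Psi_limsup dot_norm gamma_gt0 Phi_chain Psi_chain Phi_cvx Psi_cvx Phi_ge0 mPsi
    eps_gt0' epsd deps0 eps_cvg0 xd vd ode (Phi0 z Sz) Gd qge GM eps_int deps_ge).
have [z0 Sz0] := S_neq0.
have Phi_lim : Phi (x t) @[t --> +oo] --> 0.
  have [q [G [M [Gd q0 qge GM]]]] := qG z0 Sz0.
  exact: (Phi_cvg0 dot_norm gamma_gt0 Phi_chain Psi_chain Phi_cvx Psi_cvx Phi_ge0 mPsi
    eps_gt0' epsd deps0 eps_cvg0 xd vd ode (Phi0 z0 Sz0) Gd qge GM).
have Psi_z0 y : C y -> Psi z0 <= Psi y by move: Sz0; rewrite S_argmin => -[_]; exact.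
have [xinf Sxinf xinf_cvg] : exists2 l, S l & forall u, dot (x t) u @[t --> +oo] --> dot l u.
  apply: (opial dot_norm _ S_neq0 dist) => U l UU FU xl.
  have Phil : Phi l <= 0.
    apply: (@weak_lsc R H dot _ U x l (gPhi l) Phi 0 _ (Phi_cvx l) xl) => e e0; apply: FU.
    by apply: (cvgr_le _ Phi_lim); rewrite add0r.
  have Psil : Psi l <= Psi z0.
    apply: (@weak_lsc R H dot _ U x l (gPsi l) Psi (Psi z0) _ (Psi_cvx l) xl) => e e0; apply: FU; exact: Psi_sup.
  rewrite S_argmin; split; last by move=> y /Psi_z0; exact: le_trans.
  by rewrite C_zero /=; apply/eqP; rewrite eq_le Phil Phi_ge0.
split.
  exists xinf => // phi phic.
  have [M hM] := continuous_linear_bound phic.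
  have [|g hg] := @riesz R H dot dot_norm phi M _ hM; first by move=> a b c; rewrite linearP.
  have phiE : (phi : H -> R^o) = fun u => dot u g by apply/funext => u; rewrite hg (dotC dot).
  by rewrite phiE; exact: (xinf_cvg g).
split=> //.
have -> : inf [set Psi z | z in C] = Psi xinf.
  apply/eqP; rewrite eq_le; apply/andP; split.
    apply: ge_inf; last by exists xinf => //; move: Sxinf; rewrite S_argmin => -[].
    by exists m => _ [y _ <-].
  apply: lb_le_inf; first by have [y Cy] := C_neq0; exists (Psi y), y.
  by move=> _ [y Cy <-]; move: Sxinf; rewrite S_argmin => -[_]; exact.
(* The upper bound is [Psi_sup] at [xinf]; the lower one comes from the affine minorant of [Psi] at
   [xinf], which is weakly continuous. *)
apply/cvgrPdist_le => e e0.
have h1 := Psi_sup xinf e Sxinf e0.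
have h2 : \forall t \near +oo, - e <= dot (x t) (gPsi xinf) - dot xinf (gPsi xinf).
  have h : dot (x t) (gPsi xinf) - dot xinf (gPsi xinf) @[t --> +oo] -->
      dot xinf (gPsi xinf) - dot xinf (gPsi xinf).
    by apply: cvgB; [exact: xinf_cvg|exact: cvg_cst].
  by apply: (cvgr_ge _ h); rewrite subrr oppr_lt0.
apply: filterS2 h1 h2 => t h1 h2.
have := Psi_cvx xinf (x t); rewrite (dotC dot) (dotBl dot) => h3.
by rewrite ler_norml; lra.
Qed.
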